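(* Let $\{x_k,y_k\}_{k\ge 0}$ be generated by $$x_{k+1}=x_k+\alpha_k\big(f(x_k,y_k)-x_k+M_{k+1}\big),\qquad y_{k+1}=y_k+\beta_k\big(g(x_k,y_k)-y_k+M'_{k+1}\big),$$ where $f,g$, the noise sequences and the step sizes satisfy all the standing assumptions (i)--(v) listed in the context, and suppose that $\beta/\alpha\le\gamma_1$ and $K_1\ge\gamma_2$. Then: (1) There exist constants $C_1,C_2>0$ such that for all $k\ge 0$, $$\mathbb{E}\big[\|x_k-x^*(y_k)\|^2\big]\le \frac{C_1}{(k+1)^{\mathfrak a}}\quad\text{and}\quad \mathbb{E}\big[\|g(x^*(y_k),y_k)-y_k\|^2\big]\le\frac{C_2}{(k+1)^{1-\mathfrak b}}.$$ (2) With probability $1$, $\|x_k-x^*(y_k)\|\to 0$ and the iterates $y_k$ converge to the set $\mathcal{Y}^*$ (i.e. the distance from $y_k$ to $\mathcal{Y}^*$ tends to $0$).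
   Context: $\|\cdot\|$ is the Euclidean norm. Let $f:\mathbb{R}^{d_1}\times\mathbb{R}^{d_2}\to\mathbb{R}^{d_1}$ and $g:\mathbb{R}^{d_1}\times\mathbb{R}^{d_2}\to\mathbb{R}^{d_2}$. The initial points $x_0\in\mathbb{R}^{d_1}$, $y_0\in\mathbb{R}^{d_2}$ are deterministic. Standing assumptions: (i) (Contraction.) There is a constant $0\le\mu<1$ with $\|f(x_1,y)-f(x_2,y)\|\le\mu\|x_1-x_2\|$ for all $x_1,x_2\in\mathbb{R}^{d_1}$, $y\in\mathbb{R}^{d_2}$. For each $y$, $x^*(y)$ denotes the unique fixed point of $f(\cdot,y)$, i.e. $f(x^*(y),y)=x^*(y)$. (ii) (Non-expansiveness.) $\|g(x^*(y_1),y_1)-g(x^*(y_2),y_2)\|\le\|y_1-y_2\|$ for all $y_1,y_2\in\mathbb{R}^{d_2}$, and the set $\mathcal{Y}^*=\{y\in\mathbb{R}^{d_2}: g(x^*(y),y)=y\}$ is non-empty. (iii) (Lipschitz.) There are constants $L,\mathfrak{c}_1>0$ such that $\|f(x_1,y_1)-f(x_2,y_2)\|+\|g(x_1,y_1)-g(x_2,y_2)\|\le L(\|x_1-x_2\|+\|y_1-y_2\|)$ and $\|f(x,y)\|+\|g(x,y)\|\le\mathfrak{c}_1(1+\|x\|+\|y\|)$ for all arguments. (iv) (Noise.) With $\mathcal{F}_k=\sigma(x_0,y_0,M_i,M'_i,\ i\le k)$, the $\mathbb{R}^{d_1}$- and $\mathbb{R}^{d_2}$-valued sequences $\{M_{k+1}\}$,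 $\{M'_{k+1}\}$ satisfy $\mathbb{E}[M_{k+1}\mid\mathcal{F}_k]=0$, $\mathbb{E}[M'_{k+1}\mid\mathcal{F}_k]=0$ and, for some constant $\mathfrak{c}_2>0$, $\mathbb{E}[\|M_{k+1}\|^2+\|M'_{k+1}\|^2\mid\mathcal{F}_k]\le\mathfrak{c}_2(1+\|x_k\|^2+\|y_k\|^2)$ for all $k\ge0$. (v) (Step sizes.) $\alpha_k=\alpha/(k+K_1)^{\mathfrak a}$ and $\beta_k=\beta/(k+K_1)^{\mathfrak b}$ with $0.5<\mathfrak a<\mathfrak b<1$, $0<\alpha,\beta\le0.5$, $K_1\ge1$, and $\beta_k^2/\alpha_k^3\le1$ for all $k\ge 0$. Define $\gamma_1=(1-\mu)/(2L^2)$ and $\gamma_2=\max\big\{\big(2\mathfrak a/((1-\mu)\alpha)\big)^{1/(1-\mathfrak a)},\ \big(2\mathfrak b/\beta\big)^{1/(1-\mathfrak b)}\big\}$. *)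

(* Defs.v *)
From HB Require Import structures.
From mathcomp Require Import all_boot all_order all_algebra.
From mathcomp Require Import all_classical all_reals all_analysis.
From mathcomp Require Import measurable_realfun.

Set Implicit Arguments.
Unset Strict Implicit.
Unset Printing Implicit Defensive.

Import Order.TTheory GRing.Theory Num.Theory.
Import numFieldNormedType.Exports.

Local Open Scope classical_set_scope.
Local Open Scope ring_scope.

(* The library norm `|v| on row vectors is the sup norm. *)
Definition enorm (R : realType) (d : nat) (v : 'rV[R]_d) : R :=
  Num.sqrt (\sum_(i < d) v 0 i ^+ 2).

Definition edist_set (R : realType) (d : nat) (v : 'rV[R]_d)
    (A : set 'rV[R]_d) : R :=
  inf [set enorm (v - z) | z in A].

(* The point x with f x y = x; it is meaningful when it exists and is unique,
   which is the case when f is a contraction in x. *)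
Definition xstar (R : realType) (d1 d2 : nat)
    (f : 'rV[R]_d1 -> 'rV[R]_d2 -> 'rV[R]_d1) (y : 'rV[R]_d2) : 'rV[R]_d1 :=
  xget 0 [set x | f x y = x].

Definition Ystar (R : realType) (d1 d2 : nat)
    (f : 'rV[R]_d1 -> 'rV[R]_d2 -> 'rV[R]_d1)
    (g : 'rV[R]_d1 -> 'rV[R]_d2 -> 'rV[R]_d2) : set 'rV[R]_d2 :=
  [set y | g (xstar f y) y = y].

Definition stepsize (R : realType) (c e K1 : R) (k : nat) : R :=
  c / (k%:R + K1) `^ e.

Definition gamma1 (R : realType) (mu L : R) : R := (1 - mu) / (2 * L ^+ 2).

Definition gamma2 (R : realType) (mu alpha beta a b : R) : R :=
  Num.max ((2 * a / ((1 - mu) * alpha)) `^ (1 / (1 - a)))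
          ((2 * b / beta) `^ (1 / (1 - b))).

Definition borelRV (R : realType) (d : nat) : set (set 'rV[R]_d) :=
  <<s @open 'rV[R]_d >>.
Arguments borelRV : clear implicits.

Definition random_vector (R : realType) (disp : measure_display)
    (T : measurableType disp) (d : nat) (X : T -> 'rV[R]_d) : Prop :=
  forall B, borelRV R d B -> measurable (X @^-1` B).

Definition preimage_borel (R : realType) (T : Type) (d : nat)
    (X : T -> 'rV[R]_d) : set (set T) :=
  [set X @^-1` B | B in borelRV R d].

(* sigma(x0, y0, M_i, M'_i, 1 <= i <= k): the noise is indexed from 1, and the
   values M 0 and M' 0 play no role. *)
Definition noise_filtration (R : realType) (T : Type) (d1 d2 : nat)
    (x0 : 'rV[R]_d1) (y0 : 'rV[R]_d2)
    (M : nat -> T -> 'rV[R]_d1) (M' : nat -> T -> 'rV[R]_d2) (k : nat) :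
    set (set T) :=
  <<s preimage_borel (fun _ : T => x0) `|` preimage_borel (fun _ : T => y0) `|`
      \bigcup_(i in [set i | (1 <= i <= k)%N])
        (preimage_borel (M i) `|` preimage_borel (M' i)) >>.

(* Y is a version of E[X | G], for a sub-sigma-algebra G and for X either
   nonnegative (possibly with infinite mean) or integrable.  The last two
   clauses then force Y to be a.e. nonnegative, respectively integrable. *)
Definition is_cond_exp (R : realType) (disp : measure_display)
    (T : measurableType disp) (P : probability T R) (G : set (set T))
    (X Y : T -> \bar R) : Prop :=
  [/\ measurable_fun setT X,
      (forall w, (0 <= X w)%E) \/ P.-integrable setT X,
      (forall B, measurable B -> G (Y @^-1` B)) &
      forall A, G A -> (\int[P]_(w in A) Y w = \int[P]_(w in A) X w)%E].

Definition is_cond_exp_vec (R : realType) (disp : measure_display)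
    (T : measurableType disp) (P : probability T R) (G : set (set T))
    (d : nat) (X Y : T -> 'rV[R]_d) : Prop :=
  forall j : 'I_d,
    P.-integrable setT (fun w => (X w 0 j)%:E) /\
    is_cond_exp P G (fun w => (X w 0 j)%:E) (fun w => (Y w 0 j)%:E).

(* Main.v *)
(* The fast error z = x - x*(y) contracts at rate (1 - mu) alpha_k; the drift of
   x*(y) costs beta_k^2 / alpha_k <= alpha_k^2, which is summable.  Together with
   the distance from y to a fixed point this gives a Lyapunov function with
   bounded mean, whence E|z_k|^2 = O(alpha_k).

   On the slow scale the map gbar(y) = g(x*(y), y) is only non-expansive and not
   smooth, so the residual |gbar(y) - y| is not almost decreasing under noise.
   Subtracting from y_k the averaged noise U_{k+1} = (1 - beta_k) U_k +
   beta_k M'_{k+1}, for which E|U_k|^2 = O(beta_k), leaves a sequence v_k that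
   follows a Krasnoselskii-Mann iteration with an error e_k such that
   E|e_k|^2 = O(alpha_k).  Its squared residual r_k grows by at most
   2 beta_k |e_k|^2 per step, while the distance to a fixed point yields
   sum_k beta_k E r_k < oo; hence E r_k = O(1 / sum_{i < k} beta_i).

   Almost surely: |z|^2, |U|^2 and r are supermartingales up to summable errors
   with means tending to 0, so Ville's maximal inequality gives convergence to
   0; the same inequality bounds v_k, and compactness turns a vanishing residual
   into a vanishing distance to the fixed point set. *)
Require Import Defs.
From HB Require Import structures.
From mathcomp Require Import all_boot all_order all_algebra.
From mathcomp Require Import all_classical all_reals all_analysis.
From mathcomp Require Import measurable_realfun.
From mathcomp Require Import ring lra.

Import Order.TTheory GRing.Theory Num.Theory.
Import numFieldNormedType.Exports.

Local Open Scope classical_set_scope.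
Local Open Scope ring_scope.

Set Implicit Arguments.
Unset Strict Implicit.

(** * Euclidean norm on row vectors *)

(** The residual tolerates an error e_k only at the price beta_k |e_k|^2, so noise of constant
    variance would cost the divergent sum of the beta_k; averaging lowers that price to order beta_k
    alpha_k. The residual carries the weight w_k = n^(1-b), n = k + K1, which grows like the partial
    sums of the beta_i, and the accumulated error stays finite because w_k beta_k alpha_k = n
    beta_k^2 alpha_k / beta <= n alpha_k^4 / beta <= alpha^2 alpha_k^2 / beta; here beta_k^2 <=
    alpha_k^3 and 2a > 1 act together.

    Noisy one-step inequalities are integrated over an arbitrary event of F_k rather than written
    with conditional expectations: the whole space gives moment bounds and rates, and the event that
    a level has not yet been passed gives the maximal inequality.

    The rate 3/4 (1 - mu) kept from the fast contraction serves twice: it exceeds the 1/4 (1 - mu)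
    that the fast error feeds into the slow distance, and the 1/2 (1 - mu) at which alpha_k itself
    may decay. *)

Definition dotv (R : realType) (d : nat) (u v : 'rV[R]_d) : R :=
  \sum_(i < d) u 0 i * v 0 i.

Section Euclidean.
Context {R : realType} {d : nat}.
Implicit Types (u v w : 'rV[R]_d) (t k : R).

Lemma dotvC u v : dotv u v = dotv v u.
Proof. by apply: eq_bigr => i _; rewrite mulrC. Qed.

Lemma dotvDl u v w : dotv (u + v) w = dotv u w + dotv v w.
Proof. by rewrite -big_split; apply: eq_bigr => i _; rewrite mxE mulrDl. Qed.

Lemma dotvZl k u v : dotv (k *: u) v = k * dotv u v.
Proof. by rewrite mulr_sumr; apply: eq_bigr => i _; rewrite mxE mulrA. Qed.

Lemma dotvDr u v w : dotv u (v + w) = dotv u v + dotv u w.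
Proof. by rewrite dotvC dotvDl !(dotvC _ u). Qed.

Lemma dotvZr k u v : dotv u (k *: v) = k * dotv u v.
Proof. by rewrite dotvC dotvZl dotvC. Qed.

Lemma enorm_ge0 u : 0 <= enorm u.
Proof. exact: sqrtr_ge0. Qed.

Lemma sqr_enormE u : enorm u ^+ 2 = \sum_(i < d) u 0 i ^+ 2.
Proof. by rewrite sqr_sqrtr//; apply: sumr_ge0 => i _; exact: sqr_ge0. Qed.

Lemma sqr_enorm_dotv u : enorm u ^+ 2 = dotv u u.
Proof. by rewrite sqr_enormE; apply: eq_bigr => i _; rewrite expr2. Qed.

Lemma sqr_enormD u v :
  enorm (u + v) ^+ 2 = enorm u ^+ 2 + 2 * dotv u v + enorm v ^+ 2.
Proof.
by rewrite !sqr_enorm_dotv dotvDl !dotvDr (dotvC v u); ring.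
Qed.

Lemma enormZ k u : enorm (k *: u) = `|k| * enorm u.
Proof.
rewrite /enorm -sqrtr_sqr -sqrtrM ?sqr_ge0// mulr_sumr.
by congr Num.sqrt; apply: eq_bigr => i _; rewrite mxE exprMn.
Qed.

Lemma enormN u : enorm (- u) = enorm u.
Proof. by rewrite -scaleN1r enormZ normrN1 mul1r. Qed.

Lemma enorm_subC u v : enorm (u - v) = enorm (v - u).
Proof. by rewrite -enormN opprB. Qed.

Lemma enorm0 : enorm (0 : 'rV[R]_d) = 0.
Proof. by rewrite -(scale0r (0 : 'rV[R]_d)) enormZ normr0 mul0r. Qed.

Lemma coord_le_enorm u i : `|u 0 i| <= enorm u.
Proof.
rewrite -sqrtr_sqr ler_wsqrtr// (bigD1 i)//= lerDl.
by apply: sumr_ge0 => j _; exact: sqr_ge0.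
Qed.

Lemma enorm_eq0 u : enorm u = 0 -> u = 0.
Proof.
move=> u0; apply/rowP => i; rewrite mxE; apply/normr0_eq0/le_anti.
by rewrite normr_ge0 -u0 coord_le_enorm.
Qed.

Lemma dotv_le u v : dotv u v <= enorm u * enorm v.
Proof.
have [u0|u0] := eqVneq (enorm u) 0.
  rewrite u0 mul0r (enorm_eq0 u0) -(scale0r (0 : 'rV[R]_d)) dotvZl.
  by rewrite mul0r.
have [v0|v0] := eqVneq (enorm v) 0.
  rewrite v0 mulr0 (enorm_eq0 v0) -(scale0r (0 : 'rV[R]_d)) dotvZr.
  by rewrite mul0r.
have up : 0 < enorm u by rewrite lt_neqAle eq_sym u0 enorm_ge0.
have vp : 0 < enorm v by rewrite lt_neqAle eq_sym v0 enorm_ge0.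
have := sqr_ge0 (enorm (enorm v *: u + (- enorm u) *: v)).
rewrite sqr_enormD dotvZl dotvZr !enormZ normrN !ger0_norm ?enorm_ge0//.
have -> : (enorm v * enorm u) ^+ 2 +
    2 * (enorm v * (- enorm u * dotv u v)) + (enorm u * enorm v) ^+ 2 =
    2 * (enorm u * enorm v) * (enorm u * enorm v - dotv u v) by ring.
by rewrite pmulr_rge0 ?subr_ge0// mulr_gt0 ?mulr_gt0.
Qed.

Lemma ler_enormD u v : enorm (u + v) <= enorm u + enorm v.
Proof.
rewrite -(@ler_pXn2r _ 2)// ?nnegrE ?addr_ge0 ?enorm_ge0//.
by rewrite sqr_enormD; have := dotv_le u v; nra.
Qed.

Lemma ler_enormB u v : enorm (u - v) <= enorm u + enorm v.
Proof. by rewrite (le_trans (ler_enormD _ _))// enormN. Qed.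

Lemma sqr_enormD_young t u v : 0 < t ->
  enorm (u + v) ^+ 2 <= (1 + t) * enorm u ^+ 2 + (1 + t^-1) * enorm v ^+ 2.
Proof.
move=> t0; rewrite sqr_enormD.
have := sqr_ge0 (t * enorm u - enorm v).
have tt : t * t^-1 = 1 by rewrite divff// gt_eqF.
have ti : 0 < t^-1 by rewrite invr_gt0.
move=> H; have := mulr_ge0 (ltW ti) H.
have -> : t^-1 * (t * enorm u - enorm v) ^+ 2 =
  (t * t^-1) * t * enorm u ^+ 2 - 2 * (t * t^-1) * (enorm u * enorm v)
   + t^-1 * enorm v ^+ 2 by ring.
by rewrite tt; have := dotv_le u v; lra.
Qed.

Lemma dotv_young (t : R) u v : 0 < t ->
  2 * dotv u v <= t * enorm u ^+ 2 + t^-1 * enorm v ^+ 2.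
Proof.
by move=> t0; have := sqr_enormD_young u v t0; rewrite sqr_enormD; lra.
Qed.

Lemma sqr_enormD_le2 u v :
  enorm (u + v) ^+ 2 <= 2 * enorm u ^+ 2 + 2 * enorm v ^+ 2.
Proof. by have := sqr_enormD_young u v ltr01; rewrite invr1; lra. Qed.

(** Strong convexity of the squared Euclidean norm. Its negative term is the source of the residual
    that [km_step] subtracts from the distance to a fixed point. *)
Lemma sqr_enorm_conv t u v :
  enorm ((1 - t) *: u + t *: v) ^+ 2 =
  (1 - t) * enorm u ^+ 2 + t * enorm v ^+ 2 - t * (1 - t) * enorm (v - u) ^+ 2.
Proof.
rewrite -(scaleN1r u) !sqr_enormD !enormZ !exprMn !real_normK ?num_real//.
by rewrite !dotvZl !dotvZr (dotvC v u); ring.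
Qed.

(** The topology on row vectors comes from the sup norm; this comparison and [norm_le_enorm] carry
    continuity and compactness over to [enorm]. *)
Lemma enorm_le_norm u : enorm u <= d%:R * `|u|.
Proof.
apply: (@le_trans _ _ (\sum_(i < d) `|u 0 i|)).
  rewrite -(@ler_pXn2r _ 2)// ?nnegrE ?enorm_ge0 ?sumr_ge0//.
  rewrite sqr_enormE expr2 mulr_suml; apply: ler_sum => i _.
  rewrite -(real_normK (num_real _)) expr2 ler_wpM2l//.
  by rewrite (bigD1 i)//= lerDl sumr_ge0.
rewrite -[d in d%:R]card_ord mulr_natl -sumr_const; apply: ler_sum => i _.
rewrite /Num.Def.normr/= mx_normrE.
exact: (le_bigmax _ (fun i : 'I_1 * 'I_d => `|u i.1 i.2|) (0, i)).
Qed.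

Lemma norm_le_enorm u : `|u| <= enorm u.
Proof.
rewrite [leLHS]mx_normrE; apply: bigmax_le; first exact: enorm_ge0.
by move=> [i j] _ /=; rewrite ord1 coord_le_enorm.
Qed.

End Euclidean.

Lemma lipschitz_enorm_continuous {R : realType} {d e : nat}
    (F : 'rV[R]_d -> 'rV[R]_e) (k : R) :
  (forall u v, enorm (F u - F v) <= k * enorm (u - v)) -> continuous F.
Proof.
move=> FL u; apply/(@cvgrPdist_le _ _ _ (nbhs u) (nbhs_filter u)) => eps eps0; near=> v.
apply: (le_trans (norm_le_enorm _)); apply: (le_trans (FL _ _)).
have k0 : 0 <= `|k| * (d%:R + 1) by rewrite mulr_ge0.
apply: (@le_trans _ _ (`|k| * (d%:R + 1) * `|u - v|)).
  apply: (@le_trans _ _ (`|k| * enorm (u - v))).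
    by rewrite ler_wpM2r ?enorm_ge0 ?ler_norm.
  rewrite -mulrA ler_wpM2l//.
  by apply: (le_trans (enorm_le_norm _)); rewrite ler_wpM2r// lerDl.
(* The added 1 makes the factor positive, so dividing by it is legitimate even for k = 0. *)
apply: (@le_trans _ _ (((`|k| * (d%:R + 1)) + 1) * `|u - v|)).
  by rewrite ler_wpM2r// lerDl.
rewrite -ler_pdivlMl ?ltr_wpDl//.
near: v; apply: (@cvgr_dist_le _ _ _ (nbhs u) (nbhs_filter u) id u cvg_id).
by rewrite mulr_gt0// invr_gt0 ltr_wpDl.
Unshelve. all: by end_near. Qed.

Lemma enorm_continuous {R : realType} {d : nat} : continuous (@enorm R d).
Proof.
move=> u; apply/(@cvgrPdist_le _ _ _ (nbhs u) (nbhs_filter u)) => eps eps0; near=> v.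
have L : `|enorm u - enorm v| <= enorm (u - v).
  have := ler_enormD (u - v) v; have := ler_enormD (v - u) u.
  by rewrite !subrK (enorm_subC v u) => h1 h2; apply/ler_normlP; split; lra.
rewrite (le_trans L)// (le_trans (enorm_le_norm _))//.
apply: (@le_trans _ _ ((d%:R + 1) * `|u - v|)).
  by rewrite ler_wpM2r// lerDl.
rewrite -ler_pdivlMl ?ltr_wpDl//.
near: v; apply: (@cvgr_dist_le _ _ _ (nbhs u) (nbhs_filter u) id u cvg_id).
by rewrite mulr_gt0// invr_gt0 ltr_wpDl.
Unshelve. all: by end_near. Qed.

(** * Fixed points and compactness *)

Section Compactness.
Context {R : realType} {d : nat}.
Implicit Types (u v z : 'rV[R]_d) (A : set 'rV[R]_d).

Lemma compact_enorm_ball (r : R) : compact [set v : 'rV[R]_d | enorm v <= r].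
Proof.
apply: bounded_closed_compact; last first.
  rewrite (_ : [set v | _] = @enorm R d @^-1` [set t | t <= r])//.
  by apply: closed_comp; [move=> v _; exact: enorm_continuous|exact: closed_le].
exists r; split; first exact: num_real.
by move=> s rs v /= vr; rewrite (le_trans (norm_le_enorm _))// (le_trans vr) ?ltW.
Qed.

(** Compactness replaces iteration: the ball of radius |F 0| / (1 - mu) is mapped into itself, and
    at a minimizer c of |F v - v| on it the residual at F c is at most mu |F c - c|, so minimality
    forces |F c - c| = 0. *)
Lemma contraction_fixpoint (F : 'rV[R]_d -> 'rV[R]_d) (mu : R) :
  0 <= mu < 1 -> (forall u v, enorm (F u - F v) <= mu * enorm (u - v)) ->
  exists v, F v = v.
Proof.
move=> /andP[mu0 mu1] hF; pose r := enorm (F 0) / (1 - mu).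
have mu1' : 0 < 1 - mu by lra.
have FB v : enorm v <= r -> enorm (F v) <= r.
  move=> vr; have := ler_enormD (F v - F 0) (F 0); rewrite subrK.
  have := hF v 0; rewrite subr0 => h1 h2.
  have : enorm (F 0) = r * (1 - mu) by rewrite /r divfK// gt_eqF.
  have : mu * enorm v <= mu * r by rewrite ler_wpM2l.
  by lra.
have [c cB cmin] : exists2 c, c \in [set v : 'rV[R]_d | enorm v <= r] &
    forall t, t \in [set v : 'rV[R]_d | enorm v <= r] ->
      enorm (F c - c) <= enorm (F t - t).
  apply: EVT_min_rV; [|exact: compact_enorm_ball|].
    by exists 0; rewrite /= enorm0 divr_ge0 ?enorm_ge0// ltW.
  apply: continuous_subspaceT => v.
  apply: (@continuous_comp _ _ _ (fun v => F v - v) (@enorm R d));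
    last exact: enorm_continuous.
  apply: (@lipschitz_enorm_continuous _ _ _ _ (1 + 1)) => u w.
  have -> : F u - u - (F w - w) = (F u - F w) - (u - w).
    by rewrite !opprB !addrA [LHS]addrAC (addrAC (F u)) -!addrA (addrC w).
  rewrite mulrDl mul1r (le_trans (ler_enormB _ _))// lerD2r.
  by rewrite (le_trans (hF _ _))// ler_piMl ?enorm_ge0// ltW.
rewrite inE/= in cB.
exists c; apply/subr0_eq/enorm_eq0/le_anti; rewrite enorm_ge0 andbT.
have := cmin (F c); rewrite inE/= => /(_ (FB _ cB)); have := hF (F c) c.
have := enorm_ge0 (F c - c); nra.
Qed.

Lemma edist_set_le v z A : A z -> edist_set v A <= enorm (v - z).
Proof.
move=> Az; apply: ge_inf; last by exists z.
by exists 0 => _ [w _ <-]; exact: enorm_ge0.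
Qed.

Lemma edist_set_ge0 v A : 0 <= edist_set v A.
Proof.
have [->|/set0P A0] := eqVneq A set0; first by rewrite /edist_set image_set0 inf0.
by apply: lb_le_inf; [exact: image_nonempty|move=> _ [z _ <-]; exact: enorm_ge0].
Qed.

Lemma edist_set_lipschitz u v A : A !=set0 ->
  edist_set u A <= enorm (u - v) + edist_set v A.
Proof.
move=> A0; rewrite -lerBlDl; apply: lb_le_inf; first exact: image_nonempty.
move=> _ [z Az <-]; rewrite lerBlDl (le_trans (edist_set_le u Az))//.
by have := ler_enormD (u - v) (v - z); rewrite addrA subrK.
Qed.

(* The residual is bounded below on the compact set of points of the ball at
   distance at least e from the zero set. *)
Lemma residual_cvg_dist (G : 'rV[R]_d -> 'rV[R]_d) (k B : R)
    (v : nat -> 'rV[R]_d) :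
  [set z | G z = z] !=set0 ->
  (forall u w, enorm (G u - G w) <= k * enorm (u - w)) ->
  (forall n, enorm (v n) <= B) ->
  (fun n => enorm (G (v n) - v n)) @ \oo --> (0 : R) ->
  (fun n => edist_set (v n) [set z | G z = z]) @ \oo --> (0 : R).
Proof.
move=> Z0 hG vB vr; apply/cvgrPdist_lt => e e0.
set Z := [set z | G z = z] in Z0 *.
pose K := [set w | enorm w <= B] `&` [set w | e <= edist_set w Z].
have edistC : continuous (fun w => edist_set w Z).
  move=> u; apply/(@cvgrPdist_lt _ _ _ (nbhs u) (nbhs_filter u)) => eps eps0.
  have := @enorm_continuous R d 0.
  rewrite /continuous_at enorm0 => E0.
  have S0 : (fun w => u - w) @ u --> (0 : 'rV[R]_d).
    rewrite -[X in _ --> X](subrr u).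
    by apply: (@cvgB _ _ _ (nbhs u) (nbhs_filter u)); [exact: cvg_cst|exact: cvg_id].
  have := @cvg_comp _ _ _ _ _ _ _ _ S0 E0.
  move=> /(@cvgrPdist_lt _ _ _ (nbhs u) (nbhs_filter u)) /(_ _ eps0).
  apply: filterS => w /=; rewrite sub0r normrN ger0_norm ?enorm_ge0// => uw.
  apply: le_lt_trans uw; apply/ler_normlP; split.
    by have := edist_set_lipschitz w u Z0; rewrite enorm_subC; lra.
  by have := edist_set_lipschitz u w Z0; lra.
have cK : compact K.
  apply: compact_closedI; first exact: compact_enorm_ball.
  rewrite (_ : [set w | _] = (fun w => edist_set w Z) @^-1` [set t | e <= t])//.
  by apply: closed_comp; [move=> w _; exact: edistC|exact: closed_ge].
(* The extreme value theorem needs a point of [K]; if [K] is empty, every [v n] already lies at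
   distance less than e from [Z]. *)
have [K0|/set0P K0] := eqVneq K set0.
  near=> n; rewrite (distrC 0) subr0 ger0_norm ?edist_set_ge0// ltNge; apply/negP => h.
  have : K (v n) by split => //=; exact: vB.
  by rewrite K0.
have [c cK' cmin] : exists2 c, c \in K & forall t, t \in K ->
    enorm (G c - c) <= enorm (G t - t).
  apply: EVT_min_rV => //; apply: continuous_subspaceT => u.
  apply: (@continuous_comp _ _ _ (fun v => G v - v) (@enorm R d));
    last exact: enorm_continuous.
  apply: (@lipschitz_enorm_continuous _ _ _ _ (k + 1)) => w w'.
  have -> : G w - w - (G w' - w') = (G w - G w') - (w - w').
    by rewrite !opprB !addrA [LHS]addrAC (addrAC (G w)) -!addrA (addrC w').
  by rewrite mulrDl mul1r (le_trans (ler_enormB _ _))// lerD2r.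
rewrite inE in cK'.
have m0 : 0 < enorm (G c - c).
  rewrite lt_neqAle enorm_ge0 andbT eq_sym; apply/negP => /eqP/enorm_eq0/subr0_eq Gc.
  case: cK' => _ /=; apply/negP; rewrite -ltNge.
  by rewrite (le_lt_trans (@edist_set_le c c Z Gc))// subrr enorm0.
move/cvgrPdist_lt : vr => /(_ _ m0); apply: filterS => n.
rewrite !(distrC 0) !subr0 !ger0_norm ?enorm_ge0 ?edist_set_ge0// => h.
rewrite ltNge; apply/negP => h'; move: h; apply/negP; rewrite -leNgt.
by apply: cmin; rewrite inE; split => //=; exact: vB.
Unshelve. all: by end_near. Qed.

End Compactness.

(** * One-step estimates *)

Section OneStep.
Context {R : realType} {d1 d2 : nat}.
Context (f : 'rV[R]_d1 -> 'rV[R]_d2 -> 'rV[R]_d1)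
        (g : 'rV[R]_d1 -> 'rV[R]_d2 -> 'rV[R]_d2) (mu L : R) (ys : 'rV[R]_d2).
Context (mu_ge0 : 0 <= mu) (mu_lt1 : mu < 1)
  (hcontr : forall x1 x2 z, enorm (f x1 z - f x2 z) <= mu * enorm (x1 - x2))
  (hnonexp : forall y1 y2,
     enorm (g (xstar f y1) y1 - g (xstar f y2) y2) <= enorm (y1 - y2))
  (hys : Ystar f g ys) (hL : 0 < L)
  (hLip : forall x1 x2 y1 y2,
     enorm (f x1 y1 - f x2 y2) + enorm (g x1 y1 - g x2 y2)
       <= L * (enorm (x1 - x2) + enorm (y1 - y2))).

Local Notation c := (1 - mu).
Local Notation xs := (xstar f).
Local Notation gbar := (fun y => g (xstar f y) y).

Let L_ge0 : 0 <= L := ltW hL.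

Let rate_gt0 : 0 < c. Proof. by rewrite subr_gt0. Qed.

Lemma f_lipschitz x1 x2 y1 y2 :
  enorm (f x1 y1 - f x2 y2) <= L * (enorm (x1 - x2) + enorm (y1 - y2)).
Proof.
by apply: le_trans (hLip _ _ _ _); rewrite lerDl enorm_ge0.
Qed.

Lemma g_lipschitz x1 x2 y1 y2 :
  enorm (g x1 y1 - g x2 y2) <= L * (enorm (x1 - x2) + enorm (y1 - y2)).
Proof.
by apply: le_trans (hLip _ _ _ _); rewrite lerDr enorm_ge0.
Qed.

Lemma xstarP y : f (xs y) y = xs y.
Proof.
have hmu : 0 <= mu < 1 by rewrite mu_ge0.
have [v vE] := contraction_fixpoint hmu (fun u v => hcontr u v y).
by rewrite /xstar; case: xgetP => [w _ //|/(_ v)].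
Qed.

(** Changing y at a fixed x moves f by at most L |y1 - y2|, and the contraction amplifies this
    displacement by at most 1 / (1 - mu). *)
Lemma xstar_lipschitz y1 y2 :
  enorm (xs y1 - xs y2) <= L / c * enorm (y1 - y2).
Proof.
have c0 := rate_gt0.
rewrite mulrAC ler_pdivlMr//.
have h := hcontr (xs y1) (xs y2) y1.
have := f_lipschitz (xs y2) (xs y2) y1 y2.
have := ler_enormD (f (xs y1) y1 - f (xs y2) y1) (f (xs y2) y1 - f (xs y2) y2).
by rewrite addrA subrK !xstarP subrr enorm0 in h *; lra.
Qed.

(** As [xs y] is a fixed point, the new error is a convex combination of z = x - xs y and f x y - f
    (xs y) y, with norm at most (1 - al + al mu) |z|. *)
Lemma contraction_drift al x y : 0 < al -> al <= 2^-1 ->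
  enorm (x - xs y + al *: (f x y - x)) <= (1 - c * al) * enorm (x - xs y).
Proof.
move=> al0 al1; pose z := x - xs y.
have -> : x - xs y + al *: (f x y - x) =
    (1 - al) *: z + al *: (f x y - f (xs y) y).
  by rewrite xstarP /z; apply/rowP => i; rewrite !mxE; ring.
rewrite (le_trans (ler_enormD _ _))// !enormZ !ger0_norm; [|lra..].
have := hcontr x (xs y) y; rewrite -/z => h.
have := ler_wpM2l (ltW al0) h; lra.
Qed.

(** The summand 2 comes from splitting the noise from the displacement of [xs]; 2 (L/c)^2 is the
    squared Lipschitz constant of [xs] times the cost of splitting drift from noise; 4/c is the
    inverse Young weight, and 1 comes from 2 be^2 <= al^2. *)
Definition fast_const := 2 + 2 * (L / c) ^+ 2 * (4 / c + 1).

(* No smoothness of x* is available, so the displacement of x*(y) is absorbed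
   by Young's inequality at the cost be^2 / al <= al^2. *)
Lemma fast_step al be x y m m' : 0 < al -> al <= 2^-1 -> 0 < be ->
  be ^+ 2 <= al ^+ 3 ->
  enorm (x + al *: (f x y - x + m) - xs (y + be *: (g x y - y + m'))) ^+ 2 <=
  (1 - 3 / 4 * c * al) * enorm (x - xs y) ^+ 2 +
  2 * al * dotv (x - xs y + al *: (f x y - x)) m +
  fast_const * al ^+ 2 *
    (enorm m ^+ 2 + enorm m' ^+ 2 + enorm (g x y - y) ^+ 2).
Proof.
move=> al0 al1 be0 bal.
have c0 := rate_gt0.
have c1 : c <= 1 by rewrite gerBl.
set y' := y + _.
pose z := x - xs y; pose A := z + al *: (f x y - x); pose de := xs y - xs y'.
have -> : x + al *: (f x y - x + m) - xs y' = A + (al *: m + de).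
  by rewrite /A /de /z; apply/rowP => i; rewrite !mxE; ring.
rewrite -/z -/A.
have hA : enorm A <= (1 - c * al) * enorm z by exact: contraction_drift.
have hde : enorm de ^+ 2 <=
    2 * (L / c) ^+ 2 * be ^+ 2 * (enorm (g x y - y) ^+ 2 + enorm m' ^+ 2).
  have := xstar_lipschitz y y'.
  have -> : y - y' = (- be) *: (g x y - y + m').
    by rewrite /y'; apply/rowP => i; rewrite !mxE; ring.
  rewrite enormZ normrN gtr0_norm// -/de mulrA => h.
  have lb : 0 <= L / c * be by rewrite mulr_ge0 ?divr_ge0 ?ltW.
  apply: (@le_trans _ _ ((L / c * be * enorm (g x y - y + m')) ^+ 2)).
    by rewrite ler_pXn2r ?nnegrE ?enorm_ge0// mulr_ge0// enorm_ge0.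
  rewrite exprMn; have := sqr_enormD_le2 (g x y - y) m' => h2.
  have := ler_wpM2l (sqr_ge0 (L / c * be)) h2.
  by rewrite [in X in _ <= X -> _]exprMn exprMn; lra.
have l20 : 0 <= 2 * (L / c) ^+ 2 by apply: mulr_ge0; rewrite ?sqr_ge0.
(* Young weight: small enough that (1 + c/4 al) (1 - c al)^2 still lies below 1 - 3/4 c al. *)
have ca0 : 0 < c / 4 * al by rewrite mulr_gt0// divr_gt0.
have hY := dotv_young A de ca0.
have hB := sqr_enormD_le2 (al *: m) de.
rewrite enormZ gtr0_norm// exprMn in hB.
have t3 : (c / 4 * al)^-1 * enorm de ^+ 2 <= 4 / c * al ^+ 2 *
    (2 * (L / c) ^+ 2 * (enorm (g x y - y) ^+ 2 + enorm m' ^+ 2)).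
  set Q := _ + enorm m' ^+ 2 in hde *.
  have Q0 : 0 <= 2 * (L / c) ^+ 2 * Q.
    by apply: mulr_ge0 => //; rewrite addr_ge0 ?sqr_ge0.
  rewrite mulrC ler_pdivrMr// (le_trans hde)//.
  have -> : 4 / c * al ^+ 2 * (2 * (L / c) ^+ 2 * Q) * (c / 4 * al) =
    (c^-1 * c) * (al ^+ 3 * (2 * (L / c) ^+ 2 * Q)) by field; rewrite gt_eqF.
  rewrite mulVf ?gt_eqF// mul1r.
  have := ler_wpM2r Q0 bal; lra.
have t4 : 2 * enorm de ^+ 2 <= al ^+ 2 *
    (2 * (L / c) ^+ 2 * (enorm (g x y - y) ^+ 2 + enorm m' ^+ 2)).
  set Q := _ + enorm m' ^+ 2 in hde *.
  have Q0 : 0 <= 2 * (L / c) ^+ 2 * Q.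
    by apply: mulr_ge0 => //; rewrite addr_ge0 ?sqr_ge0.
  have ba : 2 * be ^+ 2 <= al ^+ 2.
    have : al * al ^+ 2 <= 2^-1 * al ^+ 2 by rewrite ler_wpM2r ?sqr_ge0.
    by rewrite -exprS; lra.
  have := ler_wpM2r Q0 ba; lra.
have t1 : (1 + c / 4 * al) * enorm A ^+ 2 <= (1 - 3 / 4 * c * al) * enorm z ^+ 2.
  have s0 : 0 < c * al by rewrite mulr_gt0.
  have s1 : c * al <= 2^-1.
    by apply: le_trans al1; rewrite ler_piMl// ltW.
  have hA2 : enorm A ^+ 2 <= ((1 - c * al) * enorm z) ^+ 2.
    by rewrite ler_pXn2r ?nnegrE ?mulr_ge0 ?enorm_ge0//; lra.
  have s2 : 0 <= 1 + c / 4 * al by lra.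
  apply: (le_trans (ler_wpM2l s2 hA2)).
  rewrite exprMn mulrA ler_wpM2r ?sqr_ge0//.
  set s := c * al in s0 s1 *.
  have -> : c / 4 * al = s / 4 by rewrite /s; ring.
  have -> : 3 / 4 * c * al = 3 / 4 * s by rewrite /s; ring.
  nra.
rewrite sqr_enormD dotvDr dotvZr.
move: hY hB t3 t4 t1; rewrite /fast_const.
have : 0 <= al ^+ 2 * (2 * (L / c) ^+ 2 * (4 / c + 1)) * enorm m ^+ 2.
  apply: mulr_ge0; rewrite ?sqr_ge0//; apply: mulr_ge0; rewrite ?sqr_ge0//.
  by apply: mulr_ge0 => //; rewrite addr_ge0 ?divr_ge0 ?ltW.
have : 0 <= al ^+ 2 * (enorm m' ^+ 2 + enorm (g x y - y) ^+ 2).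
  by rewrite mulr_ge0 ?addr_ge0 ?sqr_ge0.
set a1 := (L / c) ^+ 2; set a2 := al ^+ 2; set a4 := 4 / c.
set e1 := enorm m ^+ 2; set e2 := enorm m' ^+ 2; set e3 := enorm (g x y - y) ^+ 2.
lra.
Qed.

Definition slow_const := 4 * L ^+ 2 / c + L ^+ 2.

(** Non-expansiveness alone gives no decrease of |y - ys|. The cross term 2 be L |z| |y - ys| is
    split so that z receives c/4 al, a fraction of the gain in [fast_step], while |y - ys|^2
    receives 4 L^2/c be^2/al, hence only order al^2. *)
Lemma slow_step al be x y m' : 0 < al -> al <= 2^-1 -> 0 < be -> be <= 2^-1 ->
  be ^+ 2 <= al ^+ 3 ->
  enorm (y + be *: (g x y - y + m') - ys) ^+ 2 <=
  enorm (y - ys) ^+ 2 + c / 4 * al * enorm (x - xs y) ^+ 2 +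
  slow_const * al ^+ 2 * (enorm (x - xs y) ^+ 2 + enorm (y - ys) ^+ 2) +
  2 * be * dotv (y - ys + be *: (g x y - y)) m' + al ^+ 2 * enorm m' ^+ 2.
Proof.
move=> al0 al1 be0 be1 bal.
have c0 := rate_gt0.
pose D := y - ys; pose q := D + be *: (g x y - y).
have -> : y + be *: (g x y - y + m') - ys = q + be *: m'.
  by rewrite /q /D; apply/rowP => i; rewrite !mxE; ring.
rewrite sqr_enormD enormZ gtr0_norm// dotvZr exprMn -/D -/q.
have ba : be ^+ 2 <= al ^+ 2.
  have : al * al ^+ 2 <= 2^-1 * al ^+ 2 by rewrite ler_wpM2r ?sqr_ge0.
  by rewrite -exprS; have := sqr_ge0 al; lra.
set Z := enorm (x - xs y).
have hq : enorm q <= enorm D + be * L * Z.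
  have -> : q = (1 - be) *: D + be *: (gbar y - gbar ys) +
      be *: (g x y - gbar y).
    by rewrite hys /q /D; apply/rowP => i; rewrite !mxE; ring.
  rewrite (le_trans (ler_enormD _ _))// (le_trans (lerD (ler_enormD _ _) (lexx _)))//.
  rewrite !enormZ !ger0_norm; [|lra..].
  have h1 := ler_wpM2l (ltW be0) (hnonexp y ys).
  have := ler_wpM2l (ltW be0) (g_lipschitz x (xs y) y y).
  rewrite -/D in h1 *; rewrite subrr enorm0 -/Z; lra.
have Z0 : 0 <= Z by exact: enorm_ge0.
have hq2 : enorm q ^+ 2 <= (enorm D + be * L * Z) ^+ 2.
  by rewrite ler_pXn2r ?nnegrE ?enorm_ge0// addr_ge0 ?enorm_ge0// !mulr_ge0// ltW.
have cross : 2 * enorm D * (be * L * Z) <=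
    c / 4 * al * Z ^+ 2 + 4 * L ^+ 2 / c * al ^+ 2 * enorm D ^+ 2.
  have ca0 : 0 < c / 4 * al by rewrite mulr_gt0// divr_gt0.
  have := sqr_ge0 (c / 4 * al * Z - be * L * enorm D).
  have -> : (c / 4 * al * Z - be * L * enorm D) ^+ 2 =
     (c / 4 * al) * (c / 4 * al * Z ^+ 2 - 2 * enorm D * (be * L * Z)) +
     be ^+ 2 * (L * enorm D) ^+ 2 by ring.
  have h := ler_wpM2r (sqr_ge0 (L * enorm D)) bal.
  have -> : 4 * L ^+ 2 / c * al ^+ 2 * enorm D ^+ 2 =
     (c / 4 * al)^-1 * (al ^+ 3 * (L * enorm D) ^+ 2).
    by field; rewrite !gt_eqF.
  move=> h2.
  have h3 : 0 <= (c / 4 * al) * (c / 4 * al * Z ^+ 2 - 2 * enorm D * (be * L * Z))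
    + al ^+ 3 * (L * enorm D) ^+ 2 by lra.
  have := mulr_ge0 (ltW (_ : 0 < (c / 4 * al)^-1)) h3.
  rewrite invr_gt0 => /(_ ca0); rewrite mulrDr mulKf ?gt_eqF//; lra.
have sq : (be * L * Z) ^+ 2 <= L ^+ 2 * al ^+ 2 * Z ^+ 2.
  have := ler_wpM2r (sqr_ge0 (L * Z)) ba; lra.
have hm := ler_wpM2r (sqr_ge0 (enorm m')) ba.
rewrite /slow_const.
have p1 : 0 <= 4 * L ^+ 2 / c * al ^+ 2 * Z ^+ 2.
  by rewrite mulr_ge0 ?sqr_ge0// mulr_ge0 ?sqr_ge0// divr_ge0 ?mulr_ge0 ?sqr_ge0// ltW.
have p2 : 0 <= L ^+ 2 * al ^+ 2 * enorm D ^+ 2.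
  by rewrite mulr_ge0 ?sqr_ge0// mulr_ge0 ?sqr_ge0.
lra.
Qed.

(** The map gbar - id is 2-Lipschitz and vanishes at [ys], whence 8 = 2 * 2^2. *)
Lemma drift_bound x y :
  enorm (g x y - y) ^+ 2 <=
  2 * L ^+ 2 * enorm (x - xs y) ^+ 2 + 8 * enorm (y - ys) ^+ 2.
Proof.
have -> : g x y - y = (g x y - gbar y) + ((gbar y - gbar ys) - (y - ys)).
  by rewrite hys; apply/rowP => i; rewrite !mxE; ring.
rewrite (le_trans (sqr_enormD_le2 _ _))//.
have h1 : enorm (g x y - gbar y) ^+ 2 <= (L * enorm (x - xs y)) ^+ 2.
  rewrite ler_pXn2r ?nnegrE ?enorm_ge0 ?mulr_ge0 ?enorm_ge0//.
  by have := g_lipschitz x (xs y) y y; rewrite subrr enorm0 addr0.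
have h2 : enorm (gbar y - gbar ys - (y - ys)) ^+ 2 <= (2 * enorm (y - ys)) ^+ 2.
  rewrite ler_pXn2r ?nnegrE ?enorm_ge0 ?mulr_ge0 ?enorm_ge0//.
  by have := ler_enormB (gbar y - gbar ys) (y - ys); have := hnonexp y ys; lra.
lra.
Qed.

Definition growth_const :=
  3 + 2 * enorm ys ^+ 2 + 4 * enorm (xs ys) ^+ 2 + 4 * (L / c) ^+ 2.

(** Converts the variance bound, stated in |x| and |y|, into the quantities of the Lyapunov
    function, through x = (x - xs y) + (xs y - xs ys) + xs ys. *)
Lemma growth_bound x y :
  1 + enorm x ^+ 2 + enorm y ^+ 2 <=
  growth_const * (1 + enorm (x - xs y) ^+ 2 + enorm (y - ys) ^+ 2).
Proof.
have h1 := sqr_enormD_le2 (x - xs y) (xs y); rewrite subrK in h1.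
have h2 := sqr_enormD_le2 (y - ys) ys; rewrite subrK in h2.
have h3 := sqr_enormD_le2 (xs y - xs ys) (xs ys); rewrite subrK in h3.
have c0 := rate_gt0.
have h4 : enorm (xs y - xs ys) ^+ 2 <= (L / c * enorm (y - ys)) ^+ 2.
  rewrite ler_pXn2r ?nnegrE ?enorm_ge0//; first exact: xstar_lipschitz.
  by rewrite mulr_ge0 ?enorm_ge0// divr_ge0// ltW.
rewrite exprMn in h4; rewrite /growth_const.
set l2 := (L / c) ^+ 2 in h4 *.
have : 0 <= l2 by exact: sqr_ge0.
have := sqr_ge0 (enorm ys); have := sqr_ge0 (enorm (xs ys)).
have := sqr_ge0 (enorm (x - xs y)); have := sqr_ge0 (enorm (y - ys)).
set e1 := enorm (x - xs y) ^+ 2 in h1 *; set e2 := enorm (y - ys) ^+ 2 in h2 h4 *.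
set e3 := enorm ys ^+ 2 in h2 *; set e4 := enorm (xs ys) ^+ 2 in h3 *.
move=> p1 p2 p3 p4 p5.
have q1 := mulr_ge0 p1 p3; have q2 := mulr_ge0 p1 p4; have q3 := mulr_ge0 p2 p3.
have q4 := mulr_ge0 p2 p4; have q5 := mulr_ge0 p5 p2.
lra.
Qed.

(* The exact Krasnoselskii-Mann step does not increase the residual: if
   u = gbar v' - gbar v and s = v' - v then |u| <= |s| gives
   2 <s, u - s> <= - |u - s|^2, whose slack absorbs the error term. *)
Lemma residual_step be v q v' : 0 < be -> be <= 2^-1 ->
  v' = v + be *: (q - v) ->
  enorm (gbar v' - v') ^+ 2 <=
  enorm (gbar v - v) ^+ 2 + 2 * be * enorm (q - gbar v) ^+ 2.
Proof.
move=> be0 be1 v'E.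
pose u := gbar v' - gbar v; pose s := v' - v; pose r := gbar v - v.
pose n := q - gbar v.
rewrite -/r -/n.
have -> : gbar v' - v' = r + (u - s).
  by rewrite /r /u /s; apply/rowP => i; rewrite !mxE; ring.
have sE : s = be *: (r + n).
  by rewrite /s v'E /r /n; apply/rowP => i; rewrite !mxE; ring.
have us : enorm u ^+ 2 <= enorm s ^+ 2.
  by rewrite ler_pXn2r ?nnegrE ?enorm_ge0//; exact: hnonexp.
have h1 : 2 * dotv s (u - s) <= - enorm (u - s) ^+ 2.
  have := sqr_enormD s (u - s).
  by rewrite [X in enorm X](_ : s + (u - s) = u); [lra|rewrite addrC subrK].
rewrite sE dotvZl dotvDl -sE in h1.
(* With this weight the error term spends half of |u - s|^2; the other half pays for be |u - s|^2,
   as be <= 1/2. *)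
have t0 : 0 < 2 * be by lra.
have h2 := dotv_young (n) (- (u - s)) t0.
rewrite -(scaleN1r (u - s)) dotvZr enormZ normrN1 mul1r in h2.
rewrite sqr_enormD.
have h3 : 2 * be * ((2 * be)^-1 * enorm (u - s) ^+ 2) = enorm (u - s) ^+ 2.
  by rewrite mulrA mulfV ?mul1r// gt_eqF.
have h4 := ler_wpM2l (ltW be0) h2.
have h5 : be * enorm (u - s) ^+ 2 <= 2^-1 * enorm (u - s) ^+ 2.
  by rewrite ler_wpM2r ?sqr_ge0.
rewrite -(ler_pM2l be0); lra.
Qed.

(** The exact step [w] is a convex combination, and [sqr_enorm_conv] gains be (1 - be) >= be/2 times
    the squared residual. The error is split off with Young weight al^2: the growth factor stays
    summable, and (1 + al^-2) be^2 <= 2 al. *)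
Lemma km_step al be v q : 0 < al -> al <= 2^-1 -> 0 < be -> be <= 2^-1 ->
  be ^+ 2 <= al ^+ 3 ->
  enorm (v + be *: (q - v) - ys) ^+ 2 <=
  (1 + al ^+ 2) * enorm (v - ys) ^+ 2 - be / 2 * enorm (gbar v - v) ^+ 2 +
  2 * al * enorm (q - gbar v) ^+ 2.
Proof.
move=> al0 al1 be0 be1 bal.
pose w := (1 - be) *: (v - ys) + be *: (gbar v - ys).
have -> : v + be *: (q - v) - ys = w + be *: (q - gbar v).
  by rewrite /w; apply/rowP => i; rewrite !mxE; ring.
have hw := sqr_enorm_conv be (v - ys) (gbar v - ys).
rewrite -/w opprB addrA subrK in hw.
have hg : enorm (gbar v - ys) ^+ 2 <= enorm (v - ys) ^+ 2.
  rewrite ler_pXn2r ?nnegrE ?enorm_ge0//.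
  by rewrite -[X in _ - X]hys; exact: hnonexp.
have a2 : 0 < al ^+ 2 by rewrite exprn_gt0.
have := sqr_enormD_young w (be *: (q - gbar v)) a2.
rewrite enormZ gtr0_norm// exprMn.
set E := enorm (q - gbar v) ^+ 2.
have E0 : 0 <= E by exact: sqr_ge0.
have e1 : (1 + (al ^+ 2)^-1) * (be ^+ 2 * E) <= 2 * al * E.
  rewrite mulrA ler_wpM2r//.
  have i1 : (al ^+ 2)^-1 * be ^+ 2 <= al.
    by rewrite mulrC ler_pdivrMr// -exprS.
  have i2 : be ^+ 2 <= al.
    have a21 : al ^+ 2 <= 1 by nra.
    by have := ler_wpM2l (ltW al0) a21; rewrite -exprS mulr1; apply: le_trans.
  lra.
have h1 := ler_wpM2l (ltW be0) hg.
have h2 : be / 2 * enorm (gbar v - v) ^+ 2 <=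
    be * (1 - be) * enorm (gbar v - v) ^+ 2.
  rewrite ler_wpM2r ?sqr_ge0// ler_wpM2l//; first exact: ltW.
  by lra.
have p0 : 0 <= be / 2 * enorm (gbar v - v) ^+ 2.
  by rewrite mulr_ge0 ?sqr_ge0 ?divr_ge0 ?ltW.
have hw2 : enorm w ^+ 2 <= enorm (v - ys) ^+ 2 by lra.
have := ler_wpM2l (ltW a2) hw2; lra.
Qed.

Lemma slow_error_bound x y v :
  enorm (g x y - gbar v) ^+ 2 <=
  2 * L ^+ 2 * enorm (x - xs y) ^+ 2 + 2 * enorm (y - v) ^+ 2.
Proof.
have -> : g x y - gbar v = (g x y - gbar y) + (gbar y - gbar v).
  by rewrite addrA subrK.
rewrite (le_trans (sqr_enormD_le2 _ _))//.
have h1 : enorm (g x y - gbar y) ^+ 2 <= (L * enorm (x - xs y)) ^+ 2.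
  rewrite ler_pXn2r ?nnegrE ?enorm_ge0 ?mulr_ge0 ?enorm_ge0//.
  by have := g_lipschitz x (xs y) y y; rewrite subrr enorm0 addr0.
have h2 : enorm (gbar y - gbar v) ^+ 2 <= enorm (y - v) ^+ 2.
  by rewrite ler_pXn2r ?nnegrE ?enorm_ge0//; exact: hnonexp.
lra.
Qed.

(** Carries the rate of the averaged iterate v back to y, at the cost of the averaged noise y -
    v. *)
Lemma residual_lipschitz y v :
  enorm (gbar y - y) <= enorm (gbar v - v) + 2 * enorm (y - v).
Proof.
have -> : gbar y - y = (gbar v - v) + ((gbar y - gbar v) - (y - v)).
  by apply/rowP => i; rewrite !mxE; ring.
rewrite (le_trans (ler_enormD _ _))// lerD2l.
by rewrite (le_trans (ler_enormB _ _))//; have := hnonexp y v; lra.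
Qed.

End OneStep.

(** * Step sizes and scalar recursions *)

Section StepSizes.
Context {R : realType}.
Implicit Types k : nat.

Lemma powR_addE (t u v : R) : 0 < t -> t `^ (u + v) = t `^ u * t `^ v.
Proof. by move=> t0; rewrite powRD// (gt_eqF t0) implybT. Qed.

Lemma stepsize_gt0 (r e K1 : R) k : 0 < r -> 1 <= K1 -> 0 < stepsize r e K1 k.
Proof.
move=> r0 hK; rewrite divr_gt0// powR_gt0// ltr_wpDl//.
exact: lt_le_trans hK.
Qed.

Lemma stepsize_le (r e K1 : R) k : 0 < r -> 0 <= e -> 1 <= K1 ->
  stepsize r e K1 k <= r / k.+1%:R `^ e.
Proof.
move=> r0 e0 hK; have K0 : 0 < K1 := lt_le_trans ltr01 hK.
rewrite ler_wpM2l ?(ltW r0)// lef_pV2 ?posrE ?powR_gt0 ?ltr_wpDl//.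
by apply: ge0_ler_powR; rewrite ?nnegrE ?addr_ge0 ?(ltW K0)// -natr1 lerD2l.
Qed.

Lemma stepsize_le_half (r e K1 : R) k : 0 < r -> r <= 2^-1 -> 0 <= e -> 1 <= K1 ->
  stepsize r e K1 k <= 2^-1.
Proof.
move=> r0 r1 e0 hK; have K0 : 0 < K1 := lt_le_trans ltr01 hK.
rewrite (le_trans _ r1)// ler_piMr ?(ltW r0)//.
rewrite invf_le1 ?powR_gt0 ?ltr_wpDl//.
rewrite -[leLHS](powRr0 (k%:R + K1)) ler_powR//.
by rewrite (le_trans hK)// lerDr.
Qed.

(** Tangent lines of the exponential stand in for calculus: with l = ln (1 + 1/n) <= 1/n, the ratio
    exp (- e l) is at least 1 - e l >= 1 - e/n. *)
Lemma powR_succ_ratio (n e : R) : 0 < n -> 0 <= e ->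
  n `^ (- e) * (1 - e / n) <= (n + 1) `^ (- e).
Proof.
move=> n0 e0; have n1 : 0 < n + 1 by rewrite addr_gt0.
have -> : n + 1 = n * (1 + n^-1) by rewrite mulrDr mulr1 divff ?gt_eqF.
have i0 : 0 < n^-1 by rewrite invr_gt0.
have p0 : 0 < 1 + n^-1 by rewrite addr_gt0.
rewrite powRM ?(ltW n0) ?(ltW p0)// ler_wpM2l ?powR_ge0//.
rewrite /powR gt_eqF//; apply: le_trans (expR_ge1Dx _).
rewrite lerD2l mulNr lerN2 ler_wpM2l//.
by have := expR_ge1Dx n^-1; rewrite -ler_ln ?posrE ?expR_gt0// expRK.
Qed.

(** The sequence n^-e loses at most the fraction e/n per step, which must stay below half the
    contraction q r n^-e. The lower bound on [K1] gives n^(1-e) >= 2e/(q r), that is, e/n <= q/2 * r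
    n^-e; this is the origin of both entries of [gamma2]. *)
Lemma stepsize_ratio (r e q K1 : R) k : 0 < r -> 0 < e -> e < 1 -> 0 < q ->
  1 <= K1 -> (2 * e / (q * r)) `^ (1 / (1 - e)) <= K1 ->
  (1 - q / 2 * stepsize r e K1 k) * stepsize r e K1 k <= stepsize r e K1 k.+1.
Proof.
move=> r0 e0 e1 q0 hK hg; have K0 : 0 < K1 := lt_le_trans ltr01 hK.
pose n := k%:R + K1; have n0 : 0 < n by rewrite ltr_wpDl.
have h := powR_succ_ratio n0 (ltW e0).
have nE : k.+1%:R + K1 = n + 1 by rewrite -natr1 /n; ring.
have qr0 : 0 < q * r by rewrite mulr_gt0.
rewrite /stepsize nE -/n -!powRN.
have h1 : e / n <= q / 2 * (r * n `^ (- e)).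
  have X0 : 0 < 2 * e / (q * r) by rewrite divr_gt0 ?mulr_gt0.
  have h2 : 2 * e / (q * r) <= n `^ (1 - e).
    have : ((2 * e / (q * r)) `^ (1 / (1 - e))) `^ (1 - e) <= n `^ (1 - e).
      apply: ge0_ler_powR; rewrite ?nnegrE ?powR_ge0 ?(ltW n0)//; first lra.
      by rewrite (le_trans hg)// lerDr.
    by rewrite -powRrM divfK ?powRr1 ?(ltW X0)// gt_eqF//; lra.
  rewrite ler_pdivrMr// in h2.
  rewrite ler_pdivrMr// powR_addE// in h2 *.
  rewrite powRr1 ?(ltW n0)// in h2; lra.
have p0 : 0 < n `^ (- e) by rewrite powR_gt0.
have h3 : n `^ (- e) * (1 - q / 2 * (r * n `^ (- e))) <= n `^ (- e) * (1 - e / n).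
  by rewrite ler_wpM2l ?(ltW p0)// lerD2l lerN2.
by have := ler_wpM2l (ltW r0) (le_trans h3 h); lra.
Qed.

(* Its decrements dominate the squared step sizes and it tends to 0, so it serves
   as an explicit bound for the tails of their sum. *)
Definition sq_tail (r e K1 : R) k : R :=
  4 * r ^+ 2 / (2 * e - 1) * (k%:R + K1) `^ (- (2 * e - 1)).

Lemma sq_tail_ge0 (r e K1 : R) k : 2^-1 < e -> 0 <= sq_tail r e K1 k.
Proof.
move=> e2; have s0 : 0 <= 2 * e - 1 by lra.
by rewrite mulr_ge0 ?powR_ge0// divr_ge0// mulr_ge0 ?sqr_ge0.
Qed.

Lemma stepsize_sqr_le (r e K1 : R) k : 2^-1 < e -> e < 1 -> 1 <= K1 ->
  stepsize r e K1 k ^+ 2 <= sq_tail r e K1 k - sq_tail r e K1 k.+1.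
Proof.
move=> e2 e1 hK; have K0 : 0 < K1 := lt_le_trans ltr01 hK.
pose n := k%:R + K1; have n0 : 0 < n by rewrite ltr_wpDl.
have n1 : 1 <= n by rewrite (le_trans hK)// lerDr.
pose s := 2 * e - 1; have s0 : 0 < s by rewrite /s; lra.
have nE : k.+1%:R + K1 = n + 1 by rewrite -natr1 /n; ring.
rewrite /sq_tail nE /stepsize -/n -/s -mulrBr.
have m0 : 0 < n + 1 by rewrite addr_gt0.
have hE : (r / n `^ e) ^+ 2 = r ^+ 2 * n `^ (- (s + 1)).
  rewrite exprMn -powRN -(powR_mulrn 2 (powR_ge0 n (- e))) -powRrM /s.
  by congr (_ * _ `^ _); ring.
(* A discrete integral comparison: the drop of t^-s over one unit is bounded below by the slope at
   the right endpoint. *)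
have h1 : s * (n + 1) `^ (- (s + 1)) <= n `^ (- s) - (n + 1) `^ (- s).
  rewrite [X in _ <= X `^ _ - _](_ : n = (n + 1) * (1 - (n + 1)^-1)); last first.
    by rewrite mulrBr mulr1 divff ?gt_eqF// addrK.
  have i1 : (n + 1)^-1 < 1 by rewrite invf_lt1//; lra.
  have i0 : 0 < 1 - (n + 1)^-1 by rewrite subr_gt0.
  rewrite powRM ?(ltW m0) ?(ltW i0)//.
  rewrite opprD powR_addE//.
  rewrite powR_inv1 ?(ltW m0)//.
  have : 1 + s / (n + 1) <= (1 - (n + 1)^-1) `^ (- s).
    rewrite /powR gt_eqF//; apply: le_trans (expR_ge1Dx _).
    rewrite lerD2l mulNr -mulrN ler_wpM2l ?(ltW s0)// lerNr.
    by have := expR_ge1Dx (- (n + 1)^-1); rewrite -ler_ln ?posrE ?expR_gt0// expRK.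
  have p0 : 0 <= (n + 1) `^ (- s) by exact: powR_ge0.
  by move=> h; have := ler_wpM2l p0 h; lra.
(* Since n + 1 <= 2n and s + 1 = 2e < 2, returning from n + 1 to n costs at most 2^2, the factor 4
   in [sq_tail]. *)
have h2 : 4^-1 * n `^ (- (s + 1)) <= (n + 1) `^ (- (s + 1)).
  have q0 : 0 < 2 * n by rewrite mulr_gt0.
  apply: (@le_trans _ _ ((2 * n) `^ (- (s + 1)))).
    rewrite powRM ?(ltW n0)// ler_wpM2r ?powR_ge0//.
    have -> : 4^-1 = 2 `^ (- 2%:R) :> R.
      by rewrite powRN powR_mulrn// -natrX.
    by rewrite ler_powR ?ler1n// /s; lra.
  rewrite !powRN lef_pV2 ?posrE ?powR_gt0//.
  by apply: ge0_ler_powR; rewrite ?nnegrE ?(ltW m0) ?(ltW q0)//; lra.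
rewrite hE.
have c0 : 0 <= 4 * r ^+ 2 / s.
  by apply: divr_ge0; [rewrite mulr_ge0 ?sqr_ge0|exact: ltW].
apply: le_trans (ler_wpM2l c0 h1).
have -> : 4 * r ^+ 2 / s * (s * (n + 1) `^ (- (s + 1))) =
   4 * r ^+ 2 * (n + 1) `^ (- (s + 1)) by field; rewrite gt_eqF.
have := ler_wpM2l (sqr_ge0 r) h2; lra.
Qed.

(** The increment of the weight n^(1-b) is thus bounded by a multiple of the slow step. The crude
    bound (1 + 1/n)^(1-b) <= 1 + 1/n suffices. *)
Lemma powR_weight_step (b K1 : R) k : 0 < b -> b < 1 -> 1 <= K1 ->
  (k.+1%:R + K1) `^ (1 - b) <= (k%:R + K1) `^ (1 - b) + (k%:R + K1) `^ (- b).
Proof.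
move=> b0 b1 hK; have K0 : 0 < K1 := lt_le_trans ltr01 hK.
pose n := k%:R + K1; have n0 : 0 < n by rewrite ltr_wpDl.
have -> : k.+1%:R + K1 = n * (1 + n^-1).
  by rewrite mulrDr mulr1 divff ?gt_eqF// -natr1 /n; ring.
have i0 : 0 < n^-1 by rewrite invr_gt0.
have p0 : 1 <= 1 + n^-1 by rewrite lerDl ltW.
rewrite powRM ?(ltW n0)//; last by rewrite (le_trans ler01).
rewrite -/n (_ : n `^ (- b) = n `^ (1 - b) * n^-1); last first.
  by rewrite powR_addE// powRr1 ?(ltW n0)// mulrAC divff ?gt_eqF// mul1r.
rewrite [leRHS](_ : _ = n `^ (1 - b) * (1 + n^-1)); last by ring.
rewrite ler_wpM2l ?powR_ge0//.
by rewrite -[leRHS]powRr1 ?ler_powR//; lra.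
Qed.

Lemma powR_shift_cvg0 (s K1 : R) : 0 < s -> 0 < K1 ->
  (k%:R + K1) `^ (- s) @[k --> \oo] --> (0 : R).
Proof.
move=> s0 K0; apply/cvgrPdist_lt => eps eps0; near=> k.
rewrite sub0r normrN ger0_norm ?powR_ge0//.
have n0 : 0 < k%:R + K1 by rewrite ltr_wpDl.
rewrite powRN invf_plt ?posrE ?powR_gt0//.
have -> : eps^-1 = (eps^-1 `^ s^-1) `^ s.
  by rewrite -powRrM mulVf ?powRr1 ?gt_eqF// ltW// invr_gt0.
apply: gt0_ltr_powR; rewrite ?nnegrE ?powR_ge0 ?(ltW n0)//.
rewrite (@lt_le_trans _ _ k%:R) ?lerDl ?(ltW K0)//.
near: k; exact: nbhs_infty_gtr.
Unshelve. all: by end_near. Qed.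

Lemma sq_tail_cvg0 (r e K1 : R) : 2^-1 < e -> 1 <= K1 ->
  sq_tail r e K1 k @[k --> \oo] --> (0 : R).
Proof.
move=> e2 hK; have K0 : 0 < K1 := lt_le_trans ltr01 hK.
have s0 : 0 < 2 * e - 1 by lra.
rewrite -(mulr0 (4 * r ^+ 2 / (2 * e - 1))); apply: cvgM; first exact: cvg_cst.
exact: powR_shift_cvg0.
Qed.

(** The weight times the slow step is n B^2 / beta, so the product is at most n A^4 / beta; one
    factor n A^2 is bounded by alpha^2 because n >= 1 and 2a > 1. *)
Lemma weight_product_le (alpha beta a b K1 : R) k :
  0 < alpha -> 0 < beta -> 2^-1 < a -> b < 1 -> 1 <= K1 ->
  stepsize beta b K1 k ^+ 2 <= stepsize alpha a K1 k ^+ 3 ->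
  (k%:R + K1) `^ (1 - b) * stepsize beta b K1 k * stepsize alpha a K1 k <=
  alpha ^+ 2 / beta * stepsize alpha a K1 k ^+ 2.
Proof.
move=> al0 be0 a2 b1 hK beal; have K0 : 0 < K1 := lt_le_trans ltr01 hK.
pose n := k%:R + K1; have n0 : 0 < n by rewrite ltr_wpDl.
have n1 : 1 <= n by rewrite (le_trans hK)// lerDr.
have A0 := stepsize_gt0 a k al0 hK.
have -> : (k%:R + K1) `^ (1 - b) * stepsize beta b K1 k =
    n * stepsize beta b K1 k ^+ 2 / beta.
  rewrite -/n powR_addE// powRr1 ?(ltW n0)// /stepsize -/n powRN.
  by field; rewrite !gt_eqF ?powR_gt0.
move: A0 beal; set A := stepsize alpha a K1 k; set B := stepsize beta b K1 k.
move=> A0 beal.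
have nA : n * A ^+ 2 <= alpha ^+ 2.
  rewrite /A /stepsize -/n -powRN exprMn mulrCA -[leRHS]mulr1.
  rewrite ler_wpM2l ?sqr_ge0// -(powR_mulrn 2 (powR_ge0 n (- a))) -powRrM.
  rewrite -[X in X * _](powRr1 (ltW n0)) -powR_addE// -[leRHS](powRr0 n).
  by rewrite ler_powR//; lra.
have h1 : n * B ^+ 2 / beta * A <= n * A ^+ 3 / beta * A.
  by rewrite !ler_wpM2r ?(ltW A0) ?invr_ge0 ?(ltW be0)// ler_wpM2l// ltW.
apply: (le_trans h1).
have -> : n * A ^+ 3 / beta * A = (n * A ^+ 2) * (A ^+ 2 / beta) by ring.
have -> : alpha ^+ 2 / beta * A ^+ 2 = alpha ^+ 2 * (A ^+ 2 / beta) by ring.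
by rewrite ler_wpM2r// divr_ge0 ?sqr_ge0// ltW.
Qed.

Lemma sqr_ratio_le (x y : R) : 0 < y -> x ^+ 2 / y ^+ 3 <= 1 -> x ^+ 2 <= y ^+ 3.
Proof. by move=> y0; rewrite ler_pdivrMr ?exprn_gt0// mul1r. Qed.

End StepSizes.

Section Recursions.
Context {R : realType}.
Implicit Types (al tau e : nat -> R) (k : nat).

(** Induction on e k <= D al k: the contraction 3/4 r al beats the decay 1/2 r al of the step size,
    and the margin r/4 al absorbs C al^2 once D >= 4C/r. *)
Lemma rate_recursion al e (r C : R) :
  0 < r -> 0 <= C -> (forall k, 0 < al k) -> (forall k, r * al k <= 1) ->
  (forall k, (1 - r / 2 * al k) * al k <= al k.+1) ->
  (forall k, e k.+1 <= (1 - 3 / 4 * r * al k) * e k + C * al k ^+ 2) ->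
  exists2 D, 0 < D & forall k, e k <= D * al k.
Proof.
move=> r0 C0 al0 al1 alS eS.
pose D := `|e 0| / al 0 + 4 * C / r + 1.
have d1 : 0 <= 4 * C / r by apply: divr_ge0; [exact: mulr_ge0|exact: ltW].
have d2 : 0 <= `|e 0| / al 0 by apply: divr_ge0 => //; exact: ltW.
have D0 : 0 < D by rewrite /D; lra.
exists D => //; elim=> [|k IH].
  rewrite -ler_pdivrMr//; apply: (@le_trans _ _ (`|e 0| / al 0)).
    by rewrite ler_wpM2r ?ler_norm// invr_ge0 ltW.
  by rewrite /D; lra.
apply: le_trans (eS k) _.
have := al0 k; have := al1 k; have := alS k; move: IH.
set A := al k => IH hS h1 h0.
have q : 0 <= 1 - 3 / 4 * r * A.
  by have := mulr_gt0 r0 h0; lra.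
have hD : C <= r / 4 * D.
  have -> : C = r / 4 * (4 * C / r) by field; rewrite gt_eqF.
  by apply: ler_wpM2l; [exact: divr_ge0 (ltW r0) _|rewrite /D; lra].
have i1 := ler_wpM2l q IH.
have i2 := ler_wpM2l (ltW D0) hS.
have i3 := ler_wpM2r (sqr_ge0 A) hD.
lra.
Qed.

(** The quantity (1 + e k) exp (C tau k) does not increase, since 1 + C al^2 <= exp (C (tau k - tau
    k.+1)); this replaces an infinite product. *)
Lemma bounded_recursion al tau e (C : R) : 0 <= C ->
  (forall k, 0 <= tau k) -> (forall k, 0 <= e k) ->
  (forall k, al k ^+ 2 <= tau k - tau k.+1) ->
  (forall k, e k.+1 <= (1 + C * al k ^+ 2) * e k + C * al k ^+ 2) ->
  exists2 B, 0 < B & forall k, e k <= B.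
Proof.
move=> C0 tau0 e0 altau eS.
have H k : (1 + e k) * expR (C * tau k) <= (1 + e 0) * expR (C * tau 0).
  elim: k => [//|k IH]; apply: le_trans IH.
  have -> : C * tau k = C * (tau k - tau k.+1) + C * tau k.+1 by ring.
  rewrite expRD mulrA ler_wpM2r ?expR_ge0//.
  have h := ler_wpM2l C0 (altau k).
  have h2 := expR_ge1Dx (C * (tau k - tau k.+1)).
  have h3 := eS k; have ek := e0 k.
  have h4 : 1 + e k.+1 <= (1 + e k) * (1 + C * al k ^+ 2) by lra.
  apply: (le_trans h4); rewrite ler_wpM2l; lra.
exists ((1 + e 0) * expR (C * tau 0)).
  by rewrite mulr_gt0 ?expR_gt0//; have := e0 0; lra.
move=> k; apply: le_trans (H k); have ek := e0 k.
have : 1 <= expR (C * tau k).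
  by rewrite -expR0 ler_expR mulr_ge0.
move=> h; have e1 : 0 <= 1 + e k by lra.
by have := ler_wpM2l e1 h; lra.
Qed.

Lemma telescope_le (v tau : nat -> R) (C : R) : 0 <= C ->
  (forall k, 0 <= tau k) ->
  (forall k, v k.+1 <= v k + C * (tau k - tau k.+1)) ->
  forall k, v k <= v 0 + C * tau 0.
Proof.
move=> C0 tau0 h k.
suff : v k + C * tau k <= v 0 + C * tau 0.
  by have := mulr_ge0 C0 (tau0 k); lra.
by elim: k => [//|k IH]; have := h k; lra.
Qed.

(* Monotonicity of the weighted residual, where p and q stand for the residual
   and for the squared distance to a fixed point. *)
Lemma weighted_step (w w' p p' q q' a b e Cw Ce Ca : R) :
  0 <= Cw -> 0 <= Ce -> 0 < w -> 0 < a -> a <= 2^-1 -> 0 < b -> b <= a -> 0 <= p' ->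
  w' <= w + Cw * b -> w * b * a <= Cw * a ^+ 2 ->
  p' <= p + 2 * b * e -> e <= Ce * a -> q' + b / 2 * p <= q + Ca * a ^+ 2 ->
  w' * p' + 2 * Cw * q' <=
  w * p + 2 * Cw * q + (4 * Ce * Cw + 2 * Cw * Ca) * a ^+ 2.
Proof.
move=> Cw0 Ce0 w0 a0 a1 b0 ba p'0 ww wba pp eC qq.
have wb0 : 0 <= w + Cw * b by rewrite addr_ge0 ?mulr_ge0 ?(ltW w0) ?(ltW b0).
have f1 : w' * p' <= (w + Cw * b) * (p + 2 * b * (Ce * a)).
  apply: (le_trans (ler_wpM2r p'0 ww)); apply: ler_wpM2l => //.
  by apply: (le_trans pp); rewrite lerD2l ler_wpM2l// mulr_ge0// ltW.
(* The factor 2 Cw is chosen so that the decrease b/2 p of the distance exactly pays for the term Cw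
   b p caused by the growth of the weight. *)
have f3 : 2 * Cw * q' + Cw * b * p <= 2 * Cw * q + 2 * Cw * Ca * a ^+ 2.
  by have := ler_wpM2l Cw0 qq => {f1 ww wba pp eC qq} h; lra.
have bb : b ^+ 2 * a <= a ^+ 2.
  have i1 : b ^+ 2 * a <= a ^+ 2 * 1.
    apply: ler_pM; rewrite ?sqr_ge0 ?(ltW a0)//.
      by rewrite ler_pXn2r ?nnegrE ?(ltW a0) ?(ltW b0).
    by rewrite (le_trans a1)// invf_le1// ler1n.
  by rewrite mulr1 in i1.
have f4 := ler_wpM2l Ce0 wba.
have f5 := ler_wpM2l (mulr_ge0 Ce0 Cw0) bb.
have E : (w + Cw * b) * (p + 2 * b * (Ce * a)) = w * p + Cw * b * p +
    2 * (Ce * (w * b * a)) + 2 * (Ce * Cw * (b ^+ 2 * a)) by ring.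
rewrite E in f1; clear E wb0 ww wba pp eC qq bb.
lra.
Qed.

End Recursions.

(** * Measurability and integration *)

(** Coordinatewise, so that sums and products are immediate; taking [T] to be a
    [g_sigma_algebraType G] turns the notion into adaptedness. *)
Definition vmeas (disp : measure_display) (T : measurableType disp)
    (R : realType) (d : nat) (X : T -> 'rV[R]_d) : Prop :=
  forall j, measurable_fun setT (fun w => X w 0 j).

Section VectorMeasurability.
Context {disp : measure_display} {T : measurableType disp} {R : realType}.

Lemma measurable_set_lt (h : T -> R) (r : R) :
  measurable_fun setT h -> measurable [set w | h w < r].
Proof.
move=> mh; rewrite (_ : [set _ | _] = h @^-1` `]-oo, r[%classic).
  by rewrite -[X in measurable X]setTI; exact: mh.
by apply/seteqP; split => w; rewrite /= in_itv.
Qed.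

Lemma vmeas_cst d (v : 'rV[R]_d) : vmeas (fun _ : T => v).
Proof. by move=> j; exact: measurable_cst. Qed.

Lemma vmeasD d (X Y : T -> 'rV[R]_d) :
  vmeas X -> vmeas Y -> vmeas (fun w => X w + Y w).
Proof.
move=> mX mY j; rewrite (_ : (fun w => _) = (fun w => X w 0 j + Y w 0 j)).
  exact: measurable_funD.
by apply/funext => w; rewrite mxE.
Qed.

Lemma vmeasZ d (k : R) (X : T -> 'rV[R]_d) :
  vmeas X -> vmeas (fun w => k *: X w).
Proof.
move=> mX j; rewrite (_ : (fun w => _) = (fun w => k * X w 0 j)).
  by apply: measurable_funM => //; exact: measurable_cst.
by apply/funext => w; rewrite mxE.
Qed.

Lemma measurable_sqr_enorm d (X : T -> 'rV[R]_d) :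
  vmeas X -> measurable_fun setT (fun w => enorm (X w) ^+ 2).
Proof.
move=> mX; under eq_fun do rewrite sqr_enormE.
by apply: measurable_sum => i; apply: measurable_funX; exact: mX.
Qed.

Lemma measurable_dotv d (X Y : T -> 'rV[R]_d) :
  vmeas X -> vmeas Y -> measurable_fun setT (fun w => dotv (X w) (Y w)).
Proof.
move=> mX mY; apply: measurable_sum => i.
by apply: measurable_funM; [exact: mX|exact: mY].
Qed.

(* Open sets are countable unions of boxes with rational centres and radii. *)
Lemma vmeas_open d (X : T -> 'rV[R]_d) (U : set 'rV[R]_d) :
  vmeas X -> open U -> measurable (X @^-1` U).
Proof.
move=> mX oU.
pose box (c : 'rV[rat]_d * nat) : set 'rV[R]_d :=
  [set v | forall j, `|v 0 j - ratr (c.1 0 j)| < c.2.+1%:R^-1].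
pose Q c := if pselect (box c `<=` U) then X @^-1` (box c) else set0.
rewrite (_ : X @^-1` U = \bigcup_c Q c).
  apply: countable_bigcupT_measurable; first exact: countableP.
  move=> c; rewrite /Q; case: pselect => [cU|ncU]; last exact: measurable0.
  rewrite (_ : _ @^-1` _ = \bigcap_(j in [set: 'I_d])
      [set w | `|X w 0 j - ratr (c.1 0 j)| < c.2.+1%:R^-1]).
    apply: fin_bigcap_measurable => // j _.
    apply: measurable_set_lt; apply: measurableT_comp => //.
    by apply: measurable_funB => //; exact: mX.
  by apply/seteqP; split=> w /=; [move=> h j _|move=> h j]; exact: h.
apply/seteqP; split=> w /=; last first.
  by move=> [c cT]; rewrite /Q; case: pselect => [cU|ncU]; [exact: cU|].
move=> Uw; have := oU; rewrite openE => /(_ _ Uw) /nbhs_ballP [e /= e0 eU].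
have [n ne] : exists n : nat, n.+1%:R^-1 < e / 2.
  have e20 : 0 < e / 2 by rewrite divr_gt0.
  have [n] := @ltr_add_invr R 0 (e / 2) e20.
  by rewrite add0r => h; exists n.
have n0 : 0 < n.+1%:R^-1 :> R by rewrite invr_gt0.
have hq j : exists q : rat, `|X w 0 j - ratr q| < n.+1%:R^-1.
  have /rat_in_itvoo[q] : X w 0 j - n.+1%:R^-1 < X w 0 j + n.+1%:R^-1.
    by rewrite ltrD2l gt0_cp.
  rewrite in_itv/= => /andP[q1 q2]; exists q.
  by rewrite ltr_distlC q1 q2.
pose c : 'rV[rat]_d := \row_j (projT1 (cid (hq j))).
exists (c, n) => //; rewrite /Q.
have wc : box (c, n) (X w).
  by move=> j /=; rewrite mxE; exact: (projT2 (cid (hq j))).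
case: pselect => [cU //|ncU]; exfalso; apply: ncU => v vc; apply: eU => /=.
split => // i j; rewrite (ord1 i).
have h1 := wc j; have h2 := vc j; rewrite /= in h1 h2.
rewrite /ball/= -[X in `|X|](subrKA (ratr (c 0 j))).
rewrite (le_lt_trans (ler_normD _ _))// [X in _ + X]distrC.
by rewrite (splitr e) ltrD// (lt_trans _ ne).
Qed.

Lemma vmeas_continuous d (h : 'rV[R]_d -> R) (X : T -> 'rV[R]_d) :
  continuous h -> vmeas X -> measurable_fun setT (fun w => h (X w)).
Proof.
move=> ch mX; apply: (measurability _ (RGenOpens.measurableE R)) => //.
move=> _ [_ [a [b ->] <-]]; rewrite setTI.
rewrite [X in measurable X](_ : _ = X @^-1` (h @^-1` `]a, b[%classic))//.
apply: vmeas_open => //; apply: open_comp; first by move=> v _; exact: ch.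
exact: interval_open.
Qed.

Lemma vmeas_lipschitz d e (F : 'rV[R]_d -> 'rV[R]_e) (k : R) (X : T -> 'rV[R]_d) :
  (forall u v, enorm (F u - F v) <= k * enorm (u - v)) ->
  vmeas X -> vmeas (fun w => F (X w)).
Proof.
move=> FL mX j; apply: (@vmeas_continuous _ (fun v => F v 0 j)) => // v.
apply: (@continuous_comp _ _ _ F (fun u : 'rV[R]_e => u 0 j)).
  exact: lipschitz_enorm_continuous FL _.
exact: coord_continuous.
Qed.

Lemma vmeas_row_mx d e (X : T -> 'rV[R]_d) (Y : T -> 'rV[R]_e) :
  vmeas X -> vmeas Y -> vmeas (fun w => row_mx (X w) (Y w)).
Proof.
move=> mX mY j; rewrite (_ : (fun w => _) = (fun w =>
  match fintype.split j with inl i => X w 0 i | inr i => Y w 0 i end)).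
  by case: (fintype.split j) => i; [exact: mX|exact: mY].
by apply/funext => w; rewrite mxE.
Qed.

End VectorMeasurability.

Lemma sqr_enorm_row_mx (R : realType) (d e : nat) (u : 'rV[R]_d) (v : 'rV[R]_e) :
  enorm (row_mx u v) ^+ 2 = enorm u ^+ 2 + enorm v ^+ 2.
Proof.
rewrite !sqr_enormE big_split_ord/=; congr (_ + _); apply: eq_bigr => i _.
  by rewrite row_mxEl.
by rewrite row_mxEr.
Qed.

(** Stacking both arguments into one row vector reduces to the one-variable case; each block is
    dominated by the whole, hence the constant 2k. *)
Lemma vmeas_lipschitz2 (disp : measure_display) (T : measurableType disp)
    (R : realType) (d e m : nat) (F : 'rV[R]_d -> 'rV[R]_e -> 'rV[R]_m) (k : R)
    (X : T -> 'rV[R]_d) (Y : T -> 'rV[R]_e) : 0 <= k ->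
  (forall u u' v v',
    enorm (F u v - F u' v') <= k * (enorm (u - u') + enorm (v - v'))) ->
  vmeas X -> vmeas Y -> vmeas (fun w => F (X w) (Y w)).
Proof.
move=> k0 FL mX mY.
pose G (z : 'rV[R]_(d + e)) := F (lsubmx z) (rsubmx z).
rewrite (_ : (fun w => _) = (fun w => G (row_mx (X w) (Y w)))); last first.
  by apply/funext => w; rewrite /G row_mxKl row_mxKr.
apply: (@vmeas_lipschitz _ _ _ _ _ G (k * 2)); last exact: vmeas_row_mx.
move=> u v; rewrite /G (le_trans (FL _ _ _ _))// -mulrA ler_wpM2l//.
have h := sqr_enorm_row_mx (lsubmx u - lsubmx v) (rsubmx u - rsubmx v).
rewrite -add_row_mx -opp_row_mx !hsubmxK in h.
have h1 : enorm (lsubmx u - lsubmx v) <= enorm (u - v).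
  by rewrite -(@ler_pXn2r _ 2) ?nnegrE ?enorm_ge0// h lerDl sqr_ge0.
have h2 : enorm (rsubmx u - rsubmx v) <= enorm (u - v).
  by rewrite -(@ler_pXn2r _ 2) ?nnegrE ?enorm_ge0// h lerDr sqr_ge0.
lra.
Qed.

Definition rintegrable (disp : measure_display) (T : measurableType disp)
    (R : realType) (P : {measure set T -> \bar R}) (X : T -> R) : Prop :=
  P.-integrable setT (EFin \o X).

Section RealIntegrals.
Context {disp : measure_display} {T : measurableType disp} {R : realType}.
Context (P : probability T R).
Implicit Types (X Y : T -> R) (B : set T).

Lemma rintegrable_measurable X : rintegrable P X -> measurable_fun setT X.
Proof. by move=> /integrableP[mX _]; exact/measurable_EFinP. Qed.

Lemma rintegrable_le X Y : measurable_fun setT X ->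
  (forall w, `|X w| <= Y w) -> rintegrable P Y -> rintegrable P X.
Proof.
move=> mX XY iY; apply: le_integrable iY => //; first exact/measurable_EFinP.
by move=> w _ /=; rewrite lee_fin (le_trans (XY w))// ler_norm.
Qed.

Lemma rintegrable_norm X : rintegrable P X -> rintegrable P (fun w => `|X w|).
Proof. exact: integrable_abse. Qed.

Lemma rintegrable_cst (k : R) : rintegrable P (fun=> k).
Proof. exact: finite_measure_integrable_cst. Qed.

Lemma Rint_cst (k : R) : \int[P]_w k = k.
Proof.
rewrite Rintegral_cst// [X in fine X](_ : _ = 1%E) ?mulr1//.
exact: probability_setT.
Qed.

Lemma rintegrableD X Y : rintegrable P X -> rintegrable P Y ->
  rintegrable P (fun w => X w + Y w).
Proof.
move=> iX iY; rewrite /rintegrable (_ : _ \o _ =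
  (fun w => (EFin \o X) w + (EFin \o Y) w)%E).
  exact: integrableD.
by apply/funext => w.
Qed.

Lemma rintegrableZ (k : R) X : rintegrable P X ->
  rintegrable P (fun w => k * X w).
Proof.
move=> iX; rewrite /rintegrable (_ : _ \o _ = (fun w => k%:E * (EFin \o X) w)%E).
  exact: integrableZl.
by apply/funext => w.
Qed.

Lemma rintegrable_sum n (X : 'I_n -> T -> R) :
  (forall i, rintegrable P (X i)) -> rintegrable P (fun w => \sum_(i < n) X i w).
Proof.
elim: n X => [|n IH] X iX.
  by under eq_fun do rewrite big_ord0; exact: rintegrable_cst.
under eq_fun do rewrite big_ord_recl.
by apply: rintegrableD; [exact: iX|apply: IH => i; exact: iX].
Qed.

Lemma rintegrableS B X : measurable B -> rintegrable P X ->
  P.-integrable B (EFin \o X).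
Proof. by move=> mB; apply: integrableS. Qed.

Lemma le_Rint B X Y : measurable B -> rintegrable P X -> rintegrable P Y ->
  (forall w, X w <= Y w) -> \int[P]_(w in B) X w <= \int[P]_(w in B) Y w.
Proof. by move=> mB iX iY XY; apply: le_Rintegral => //; exact: rintegrableS. Qed.

Lemma RintD B X Y : measurable B -> rintegrable P X -> rintegrable P Y ->
  \int[P]_(w in B) (X w + Y w) = \int[P]_(w in B) X w + \int[P]_(w in B) Y w.
Proof. by move=> mB iX iY; apply: RintegralD => //; exact: rintegrableS. Qed.

Lemma RintZ B (k : R) X : measurable B -> rintegrable P X ->
  \int[P]_(w in B) (k * X w) = k * \int[P]_(w in B) X w.
Proof. by move=> mB iX; apply: RintegralZl => //; exact: rintegrableS. Qed.

Lemma Rint_sum B n (X : 'I_n -> T -> R) : measurable B ->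
  (forall i, rintegrable P (X i)) ->
  \int[P]_(w in B) (\sum_(i < n) X i w) = \sum_(i < n) \int[P]_(w in B) X i w.
Proof.
move=> mB; elim: n X => [|n IH] X iX.
  under eq_Rintegral do rewrite big_ord0.
  by rewrite big_ord0 Rintegral_cst// mul0r.
under eq_Rintegral do rewrite big_ord_recl.
rewrite RintD// ?big_ord_recl ?IH//; apply: rintegrable_sum => i; exact: iX.
Qed.

Lemma EFin_Rint X : rintegrable P X ->
  (\int[P]_w X w)%:E = (\int[P]_w (X w)%:E)%E.
Proof. by move=> iX; rewrite fineK//; exact: integrable_fin_num. Qed.

Lemma rintegrable_indic B X : measurable B -> rintegrable P X ->
  rintegrable P (fun w => \1_B w * X w).
Proof.
move=> mB iX; apply: (rintegrable_le (Y := fun w => `|X w|)) => [|w|].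
- by apply: measurable_funM; [|exact: rintegrable_measurable].
- by rewrite normrM indicE; case: (_ \in _); rewrite ?normr1 ?mul1r// normr0 mul0r.
- exact: rintegrable_norm.
Qed.

Lemma Rint_indic B X : measurable B ->
  \int[P]_w (\1_B w * X w) = \int[P]_(w in B) X w.
Proof.
move=> mB; rewrite [RHS]Rintegral_mkcond; apply: eq_Rintegral => w _.
by rewrite patchE indicE; case: (_ \in _); rewrite ?mul1r// mul0r.
Qed.

Lemma Rint_subset B X : measurable B -> rintegrable P X ->
  (forall w, 0 <= X w) -> \int[P]_(w in B) X w <= \int[P]_w X w.
Proof.
move=> mB iX X0; rewrite -Rint_indic//; apply: le_Rint => //.
  exact: rintegrable_indic.
by move=> w; rewrite indicE; case: (_ \in _); rewrite ?mul1r// mul0r.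
Qed.

End RealIntegrals.

(** * Orthogonality to a sub-sigma-algebra *)

Section SubAlgebra.
Context {disp : measure_display} {T : measurableType disp} {R : realType}.
Context (P : probability T R) (G : set (set T)).
Context (Gmeas : forall A, <<s G>> A -> measurable A).
Local Notation TG := (g_sigma_algebraType G).

Import HBSimple HBNNSimple.

Lemma sub_measurable_fun (dU : measure_display) (U : measurableType dU) (X : T -> U) :
  measurable_fun (setT : set TG) X -> measurable_fun (setT : set T) X.
Proof.
move=> mX _ Y mY; rewrite setTI.
by apply: Gmeas; have := mX measurableT Y mY; rewrite setTI.
Qed.

(** G-measurable simple functions increase to h; for each of them the integral is a finite
    combination of integrals of Z over events of G, and |h Z| dominates the passage to the limit. *)
Lemma Rint_mul_eq0_nneg (h Z : T -> R) :
  measurable_fun (setT : set TG) h -> (forall w, 0 <= h w) ->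
  rintegrable P Z -> rintegrable P (fun w => h w * Z w) ->
  (forall A, <<s G>> A -> \int[P]_(w in A) Z w = 0) ->
  \int[P]_w (h w * Z w) = 0.
Proof.
move=> mh h0 iZ ihZ Z0.
have meh : measurable_fun (setT : set TG) (EFin \o h) by exact/measurable_EFinP.
pose hn := @nnsfun_approx _ TG R setT measurableT _ meh.
have mhn n : measurable_fun (setT : set T) (hn n : T -> R).
  exact: (sub_measurable_fun (X := hn n : T -> R)).
have hn_le n w : 0 <= hn n w <= h w.
  rewrite fun_ge0/= -lee_fin nnsfun_approxE.
  by apply: (le_approx (f := EFin \o h)) => // x _; rewrite lee_fin.
have ihn n : rintegrable P (fun w => hn n w * Z w).
  apply: (rintegrable_le (Y := fun w => `|h w * Z w|)).
  - by apply: measurable_funM => //; exact: rintegrable_measurable iZ.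
  - move=> w; have /andP[a1 a2] := hn_le n w.
    by rewrite !normrM ler_wpM2r// (ger0_norm a1) (ger0_norm (h0 w)).
  - exact: rintegrable_norm.
have hn0 n : \int[P]_w (hn n w * Z w) = 0.
  pose s : seq R := finmap.enum_fset (fset_set (range (hn n))).
  under eq_Rintegral do rewrite fimfunEord mulr_suml.
  have mA y : <<s G>> (hn n @^-1` [set y]).
    have : measurable ((hn n : TG -> R) @^-1` [set y]).
      by rewrite -[X in measurable X]setTI; exact: measurable_funP.
    by [].
  under eq_Rintegral do under eq_bigr do rewrite -mulrA.
  rewrite Rint_sum//; last first.
    move=> i; apply: rintegrableZ; apply: rintegrable_indic => //.
    exact: (Gmeas (mA _)).
  apply: big1 => i _; rewrite RintZ//; last first.
    by apply: rintegrable_indic => //; exact: (Gmeas (mA _)).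
  by rewrite Rint_indic ?(Z0 _ (mA _)) ?mulr0//; exact: (Gmeas (mA _)).
have D1 : {ae P, forall w, setT w ->
    (hn n w * Z w)%:E @[n --> \oo] --> (h w * Z w)%:E}.
  apply: aeW => w _; apply: cvg_EFin; first exact: nearW.
  apply: cvgM; last exact: cvg_cst.
  have := @cvg_nnsfun_approx _ TG R setT measurableT _ meh
    (fun x _ => h0 x) w Logic.I.
  by move=> /fine_cvgP[].
have D2 : {ae P, forall w n, setT w ->
    (`|(hn n w * Z w)%:E| <= `|(h w * Z w)%:E|)%E}.
  apply: aeW => w n _; have /andP[a1 a2] := hn_le n w.
  by rewrite /= lee_fin !normrM ler_wpM2r// (ger0_norm a1) (ger0_norm (h0 w)).
have [_ _] := dominated_convergence measurableT
  (fun n => measurable_int P (ihn n)) (measurable_int P ihZ) D1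
  (integrable_abse ihZ) D2.
have -> : [sequence (\int[P]_(w in setT) (hn n w * Z w)%:E)%E]_n = (fun=> 0%E).
  by apply/funext => n /=; rewrite -EFin_Rint// hn0.
move=> C; apply/EFin_inj; rewrite EFin_Rint//.
exact: (cvg_unique _ C (cvg_cst _)).
Qed.

Lemma Rint_mul_eq0 (h Z : T -> R) :
  measurable_fun (setT : set TG) h ->
  rintegrable P Z -> rintegrable P (fun w => h w * Z w) ->
  (forall A, <<s G>> A -> \int[P]_(w in A) Z w = 0) ->
  \int[P]_w (h w * Z w) = 0.
Proof.
move=> mh iZ ihZ Z0.
have mm (u : T -> R) : measurable_fun (setT : set TG) u ->
    measurable_fun (setT : set TG) (fun w => Num.max (u w) 0).
  by move=> mu; apply: measurable_maxr => //; exact: measurable_cst.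
(* Used for [h] and [- h], whose positive parts differ by [h]; equal absolute values let |h Z|
   dominate both products. *)
have key (u : T -> R) : measurable_fun (setT : set TG) u ->
    (forall w, `|u w| = `|h w|) ->
    rintegrable P (fun w => Num.max (u w) 0 * Z w) /\
    \int[P]_w (Num.max (u w) 0 * Z w) = 0.
  move=> mu uh; have iu : rintegrable P (fun w => Num.max (u w) 0 * Z w).
    apply: (rintegrable_le (Y := fun w => `|h w * Z w|)).
    - apply: measurable_funM; last exact: rintegrable_measurable iZ.
      exact: sub_measurable_fun (mm _ mu).
    - move=> w; rewrite !normrM ler_wpM2r// -uh.
      by rewrite maxEle; case: ifP => // _; rewrite normr0.
    - exact: rintegrable_norm.
  split=> //; apply: Rint_mul_eq0_nneg => //; first exact: mm.
  by move=> w; rewrite le_max lexx orbT.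
have [i1 e1] := key h mh (fun=> erefl).
have [|i2 e2] := key (fun w => - h w) _ (fun w => normrN _).
  exact: measurableT_comp.
have -> : \int[P]_w (h w * Z w) =
    \int[P]_w (Num.max (h w) 0 * Z w + -1 * (Num.max (- h w) 0 * Z w)).
  apply: eq_Rintegral => w _; rewrite mulN1r -mulrBl; congr (_ * _).
  by rewrite !maxEle; case: (leP (h w) 0) => h1; case: (leP (- h w) 0) => h2; lra.
by rewrite RintD ?RintZ ?e1 ?e2 ?mulr0 ?addr0//; exact: rintegrableZ.
Qed.

End SubAlgebra.

Section CondExp.
Context {disp : measure_display} {T : measurableType disp} {R : realType}.
Context (P : probability T R) (G : set (set T)).
Context (Gmeas : forall A, <<s G>> A -> measurable A).

(* V itself need not be nonnegative, hence the detour through its positive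
   part. *)
Lemma cond_exp_bound (N W : T -> R) (V : T -> \bar R) :
  is_cond_exp P (<<s G>>) (fun w => (N w)%:E) V ->
  {ae P, forall w, (V w <= (W w)%:E)%E} ->
  (forall w, 0 <= N w) -> (forall w, 0 <= W w) -> rintegrable P W ->
  rintegrable P N /\
  forall B, <<s G>> B -> \int[P]_(w in B) N w <= \int[P]_(w in B) W w.
Proof.
move=> [mN _ mV VE] VW N0 W0 iW.
have mVT : measurable_fun (setT : set T) V.
  by move=> _ B mB; rewrite setTI; exact: (Gmeas (mV _ mB)).
have mW := rintegrable_measurable iW.
have le B : <<s G>> B ->
    (\int[P]_(w in B) (N w)%:E <= \int[P]_(w in B) (W w)%:E)%E.
  move=> GB; have mB := Gmeas GB.
  rewrite -VE// integralE.
  apply: (@le_trans _ _ (\int[P]_(w in B) (V^\+ w))%E).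
    by rewrite -[leRHS]adde0 leeD2l// oppe_le0 integral_ge0.
  apply: ae_ge0_le_integral => //.
  - exact: measurable_funTS (measurable_funepos mVT).
  - by move=> w _; rewrite lee_fin.
  - exact/measurable_funTS/measurable_EFinP.
  - case: VW => N' [mN' PN' subN']; exists N'; split => //.
    move=> w nw; apply: subN' => /= VW; apply: nw => _.
    by rewrite funeposE ge_max VW lee_fin W0.
have iN : rintegrable P N.
  apply/integrableP; split; first exact: mN.
  under eq_integral => w _ do rewrite /= ger0_norm//.
  have sT : <<s G>> setT.
    by have := @measurableT _ (g_sigma_algebraType G).
  apply: le_lt_trans (le _ sT) _.
  by rewrite -EFin_Rint// ltry.
split=> // B GB; have mB := Gmeas GB.
rewrite -lee_fin; have := le _ GB.
rewrite -[X in (X <= _)%E -> _]fineK ?integrable_fin_num//; last exact: rintegrableS.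
rewrite -[X in (_ <= X)%E -> _]fineK ?integrable_fin_num//; exact: rintegrableS.
Qed.

(* Square-integrable adapted vectors *)
End CondExp.

Definition adaptedL2 (disp : measure_display) (T : measurableType disp)
    (R : realType) (P : probability T R) (G : set (set T)) (d : nat)
    (X : T -> 'rV[R]_d) : Prop :=
  vmeas (X : g_sigma_algebraType G -> 'rV[R]_d) /\
  rintegrable P (fun w => enorm (X w) ^+ 2).

Section AdaptedL2.
Context {disp : measure_display} {T : measurableType disp} {R : realType}.
Context (P : probability T R) (G : set (set T)).
Context (Gmeas : forall A, <<s G>> A -> measurable A).
Local Notation L2 := (adaptedL2 P G).

Lemma vmeas_sub d (X : T -> 'rV[R]_d) :
  vmeas (X : g_sigma_algebraType G -> 'rV[R]_d) -> vmeas X.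
Proof. by move=> mX j; apply: (sub_measurable_fun Gmeas); exact: mX. Qed.

Lemma sqr_enorm_rintegrable_le d (X : T -> 'rV[R]_d) (Y : T -> R) :
  vmeas X -> (forall w, enorm (X w) ^+ 2 <= Y w) -> rintegrable P Y ->
  rintegrable P (fun w => enorm (X w) ^+ 2).
Proof.
move=> mX XY; apply: rintegrable_le; first exact: measurable_sqr_enorm.
by move=> w; rewrite ger0_norm ?sqr_ge0.
Qed.

Lemma adaptedL2_cst d (v : 'rV[R]_d) : L2 (fun=> v).
Proof.
split; first exact: (@vmeas_cst _ (g_sigma_algebraType G)).
exact: rintegrable_cst.
Qed.

Lemma adaptedL2D d (X Y : T -> 'rV[R]_d) :
  L2 X -> L2 Y -> L2 (fun w => X w + Y w).
Proof.
move=> [mX iX] [mY iY]; have mS := vmeasD mX mY; split=> //.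
apply: (@sqr_enorm_rintegrable_le _ _
  (fun w => 2 * enorm (X w) ^+ 2 + 2 * enorm (Y w) ^+ 2)).
- exact: vmeas_sub mS.
- by move=> w; exact: sqr_enormD_le2.
- by apply: rintegrableD; exact: rintegrableZ.
Qed.

Lemma adaptedL2Z d (k : R) (X : T -> 'rV[R]_d) :
  L2 X -> L2 (fun w => k *: X w).
Proof.
move=> [mX iX]; split; first exact: (vmeasZ k mX).
under eq_fun do rewrite enormZ exprMn.
exact: rintegrableZ.
Qed.

Lemma adaptedL2B d (X Y : T -> 'rV[R]_d) :
  L2 X -> L2 Y -> L2 (fun w => X w - Y w).
Proof.
move=> lX lY; under eq_fun do rewrite -(scaleN1r (Y _)).
by apply: adaptedL2D => //; exact: adaptedL2Z.
Qed.

Lemma adaptedL2_lipschitz2 d e m (F : 'rV[R]_d -> 'rV[R]_e -> 'rV[R]_m) (k : R)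
    (X : T -> 'rV[R]_d) (Y : T -> 'rV[R]_e) : 0 <= k ->
  (forall u u' v v',
    enorm (F u v - F u' v') <= k * (enorm (u - u') + enorm (v - v'))) ->
  L2 X -> L2 Y -> L2 (fun w => F (X w) (Y w)).
Proof.
move=> k0 FL [mX iX] [mY iY].
have mF := @vmeas_lipschitz2 _ (g_sigma_algebraType G) _ _ _ _ _ _ _ _ k0 FL mX mY.
split=> //.
apply: (@sqr_enorm_rintegrable_le _ _ (fun w => 2 * enorm (F 0 0) ^+ 2 +
   (4 * k ^+ 2 * enorm (X w) ^+ 2 + 4 * k ^+ 2 * enorm (Y w) ^+ 2))).
- exact: vmeas_sub mF.
- move=> w; have := sqr_enormD_le2 (F (X w) (Y w) - F 0 0) (F 0 0).
  rewrite subrK.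
  have h : enorm (F (X w) (Y w) - F 0 0) ^+ 2 <=
      (k * (enorm (X w) + enorm (Y w))) ^+ 2.
    rewrite ler_pXn2r ?nnegrE ?enorm_ge0//.
      by have := FL (X w) 0 (Y w) 0; rewrite !subr0.
    by rewrite mulr_ge0// addr_ge0 ?enorm_ge0.
  have h2 := mulr_ge0 (sqr_ge0 k) (sqr_ge0 (enorm (X w) - enorm (Y w))).
  lra.
- apply: rintegrableD; first exact: rintegrable_cst.
  by apply: rintegrableD; exact: rintegrableZ.
Qed.

Lemma adaptedL2_lipschitz d m (F : 'rV[R]_d -> 'rV[R]_m) (k : R)
    (X : T -> 'rV[R]_d) : 0 <= k ->
  (forall u u', enorm (F u - F u') <= k * enorm (u - u')) ->
  L2 X -> L2 (fun w => F (X w)).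
Proof.
move=> k0 FL lX.
apply: (@adaptedL2_lipschitz2 _ _ _ (fun u _ => F u) k _ (fun=> 0 : 'rV[R]_0)) => //.
- move=> u u' v v'; apply: (le_trans (FL _ _)).
  by rewrite ler_wpM2l// lerDl enorm_ge0.
- exact: adaptedL2_cst.
Qed.

Lemma rintegrable_dotv d (X Y : T -> 'rV[R]_d) : vmeas X -> vmeas Y ->
  rintegrable P (fun w => enorm (X w) ^+ 2) ->
  rintegrable P (fun w => enorm (Y w) ^+ 2) ->
  rintegrable P (fun w => dotv (X w) (Y w)).
Proof.
move=> mX mY iX iY.
apply: (rintegrable_le (Y := fun w => enorm (X w) ^+ 2 + enorm (Y w) ^+ 2)).
- exact: measurable_dotv.
- move=> w; have h1 := dotv_young (X w) (Y w) ltr01.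
  have h2 := dotv_young (X w) (- 1 *: Y w) ltr01.
  rewrite dotvZr enormZ normrN1 mul1r invr1 in h2; rewrite invr1 in h1.
  by have := sqr_ge0 (enorm (X w)); have := sqr_ge0 (enorm (Y w));
    move=> p q; apply/ler_normlP; split; lra.
- exact: rintegrableD.
Qed.

(** E[Z | G] = 0 for square-integrable Z, expressed by integrals over events of G so that no version
    of the conditional mean has to be carried along. *)
Definition centered d (Z : T -> 'rV[R]_d) : Prop :=
  [/\ vmeas Z, rintegrable P (fun w => enorm (Z w) ^+ 2) &
      forall A j, <<s G>> A -> \int[P]_(w in A) Z w 0 j = 0].

(** The indicator of B is itself G-measurable, so it is absorbed into h and each coordinate falls
    under [Rint_mul_eq0]. *)
Lemma Rint_dotv_centered d (h Z : T -> 'rV[R]_d) B :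
  L2 h -> centered Z -> <<s G>> B ->
  rintegrable P (fun w => dotv (h w) (Z w)) /\
  \int[P]_(w in B) dotv (h w) (Z w) = 0.
Proof.
move=> [mh ih] [mZ iZ Z0] GB; have mB := Gmeas GB; have mhT := vmeas_sub mh.
split; first exact: rintegrable_dotv.
have ij (X Y : T -> 'rV[R]_d) j : vmeas X -> vmeas Y ->
    rintegrable P (fun w => enorm (X w) ^+ 2) ->
    rintegrable P (fun w => enorm (Y w) ^+ 2) ->
    rintegrable P (fun w => X w 0 j * Y w 0 j).
  move=> mX mY iX iY.
  apply: (rintegrable_le (Y := fun w => enorm (X w) ^+ 2 + enorm (Y w) ^+ 2)).
  - by apply: measurable_funM; [exact: mX|exact: mY].
  - move=> w; rewrite normrM.
    have h1 := coord_le_enorm (X w) j; have h2 := coord_le_enorm (Y w) j.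
    have h3 := ler_pM (normr_ge0 _) (normr_ge0 _) h1 h2.
    have h4 := sqr_ge0 (enorm (X w) - enorm (Y w)).
    have := sqr_ge0 (enorm (X w)); have := sqr_ge0 (enorm (Y w)); lra.
  - exact: rintegrableD.
rewrite Rint_sum//; last by move=> j; exact: ij.
apply: big1 => j _; rewrite -Rint_indic//.
have iZj : rintegrable P (fun w => Z w 0 j).
  apply: (rintegrable_le (Y := fun w => 1 + enorm (Z w) ^+ 2)).
  - exact: mZ.
  - move=> w; apply: (le_trans (coord_le_enorm _ _)).
    by have := sqr_ge0 (enorm (Z w) - 1); have := sqr_ge0 (enorm (Z w)); lra.
  - by apply: rintegrableD => //; exact: rintegrable_cst.
have E w : \1_B w * (h w 0 j * Z w 0 j) = (\1_B w * h w 0 j) * Z w 0 j.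
  by rewrite mulrA.
under eq_Rintegral do rewrite E.
apply: (Rint_mul_eq0 Gmeas) => //.
- apply: measurable_funM; last exact: mh.
  exact: (@measurable_indic _ (g_sigma_algebraType G)).
- under eq_fun do rewrite -E.
  by apply: rintegrable_indic => //; exact: ij.
- by move=> A GA; exact: Z0.
Qed.

(** Common pattern of the noisy recursions: cross terms integrate to 0 over events of G, and the
    squared noise is replaced by its conditional bound W. Each of the two noises has a cross term,
    which a zero vector switches off. *)
Lemma cond_step (d e : nat) (V V' W N : T -> R) (h Z : T -> 'rV[R]_d)
    (h' Z' : T -> 'rV[R]_e) (r r' q : R) (B : set T) :
  0 <= q -> <<s G>> B ->
  L2 h -> centered Z -> L2 h' -> centered Z' ->
  rintegrable P V -> rintegrable P V' -> rintegrable P N ->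
  \int[P]_(w in B) N w <= \int[P]_(w in B) W w ->
  (forall w, V' w <= V w + r * dotv (h w) (Z w) + r' * dotv (h' w) (Z' w) + q * N w) ->
  \int[P]_(w in B) V' w <= \int[P]_(w in B) V w + q * \int[P]_(w in B) W w.
Proof.
move=> q0 GB lh cZ lh' cZ' iV iV' iN NW VV'; have mB := Gmeas GB.
have [i1 e1] := Rint_dotv_centered lh cZ GB.
have [i2 e2] := Rint_dotv_centered lh' cZ' GB.
have j1 := rintegrableZ r i1; have j2 := rintegrableZ r' i2.
have j3 := rintegrableZ q iN.
have j4 := rintegrableD iV j1; have j5 := rintegrableD j4 j2.
apply: le_trans (le_Rint mB iV' (rintegrableD j5 j3) VV') _.
rewrite RintD// RintD// RintD// !RintZ// e1 e2 !mulr0 !addr0 lerD2l.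
exact: ler_wpM2l.
Qed.

End AdaptedL2.

(** * Almost sure convergence of near supermartingales *)

Section MaximalInequality.
Context {disp : measure_display} {T : measurableType disp} {R : realType}.
Context (P : probability T R) (G : nat -> set (set T)).
Context (Gmeas : forall k A, <<s G k>> A -> measurable A).
Context (Gmono : forall k A, <<s G k>> A -> <<s G k.+1>> A).
Context (V : nat -> T -> R) (tau : nat -> R) (C : R).
Context (V0 : forall k w, 0 <= V k w) (iV : forall k, rintegrable P (V k))
  (mV : forall k, measurable_fun (setT : set (g_sigma_algebraType (G k))) (V k))
  (C0 : 0 <= C) (tau0 : forall k, 0 <= tau k)
  (Vstep : forall k B, <<s G k>> B ->
    \int[P]_(w in B) V k.+1 w <= \int[P]_(w in B) V k w + C * (tau k - tau k.+1)).

Let below (lam : R) n m : set T :=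
  [set w | forall i, (i <= m)%N -> V (n + i) w < lam].

Let belowS lam n m :
  below lam n m.+1 = below lam n m `&` [set w | V (n + m.+1) w < lam].
Proof.
apply/seteqP; split=> w /=.
  by move=> h; split=> [i im|]; apply: h => //; exact: leqW.
by move=> [h h1] i; rewrite leq_eqVlt ltnS => /predU1P[->//|]; exact: h.
Qed.

Let below0 lam n : below lam n 0 = [set w | V n w < lam].
Proof.
apply/seteqP; split=> w /=; first by move=> /(_ 0%N isT); rewrite addn0.
by move=> h i; rewrite leqn0 => /eqP ->; rewrite addn0.
Qed.

Let below_adapted lam n m : <<s G (n + m)%N>> (below lam n m).
Proof.
elim: m => [|m IH].
  rewrite below0 addn0.
  exact: (@measurable_set_lt _ (g_sigma_algebraType (G n))).
rewrite belowS.
have h1 : (G (n + m.+1)%N).-sigma.-measurable (below lam n m).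
  by rewrite addnS; exact: Gmono.
apply: (@measurableI _ (g_sigma_algebraType (G (n + m.+1)%N)) _ _ h1).
exact: (@measurable_set_lt _ (g_sigma_algebraType (G (n + m.+1)%N))).
Qed.

(* The process stopped at its first passage above lam. *)
Let stopped lam n m w : R := \1_(below lam n m) w * V (n + m) w +
  lam * (1 + -1 * (\1_(below lam n m) w * 1)).

Let stopped_integrable lam n m : rintegrable P (stopped lam n m).
Proof.
have mB := Gmeas (@below_adapted lam n m).
apply: rintegrableD; first exact: rintegrable_indic.
apply: rintegrableZ; apply: rintegrableD; first exact: rintegrable_cst.
apply: rintegrableZ; apply: rintegrable_indic => //; exact: rintegrable_cst.
Qed.

(** After the passage the value is frozen at [lam], at most the value of [V] that triggered it. One
    more step therefore matters only on [below lam n m], an event of [G (n + m)], where [Vstep]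
    applies; adding C tau telescopes its error. *)
Let Rint_stopped lam n m : 0 <= lam ->
  \int[P]_w stopped lam n m w + C * tau (n + m)%N <= \int[P]_w V n w + C * tau n.
Proof.
move=> lam0; elim: m => [|m IH].
  rewrite addn0 lerD2r; apply: le_Rint => //.
  move=> w; rewrite /stopped addn0 below0 indicE.
  have := V0 n w; case: (boolP (w \in _)); rewrite ?(inE, notin_setE)/=; first lra.
  by move/negP; rewrite -leNgt; lra.
apply: le_trans IH.
have mB := Gmeas (@below_adapted lam n m).
have h := Vstep (@below_adapted lam n m); rewrite -!addnS in h.
have i1 : rintegrable P (fun w => 1 + -1 * (\1_(below lam n m) w * 1)).
  apply: rintegrableD; first exact: rintegrable_cst.
  apply: rintegrableZ; apply: rintegrable_indic => //; exact: rintegrable_cst.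
have i2 := rintegrableZ lam i1.
have ind k : rintegrable P (fun w => \1_(below lam n m) w * V k w).
  exact: rintegrable_indic.
have e1 : \int[P]_w stopped lam n m w = \int[P]_(w in below lam n m) V (n + m)%N w +
   \int[P]_w (lam * (1 + -1 * (\1_(below lam n m) w * 1))).
  by rewrite RintD// Rint_indic.
have e2 : \int[P]_w stopped lam n m.+1 w <=
   \int[P]_(w in below lam n m) V (n + m.+1)%N w +
   \int[P]_w (lam * (1 + -1 * (\1_(below lam n m) w * 1))).
  rewrite -(@Rint_indic _ _ _ P (below lam n m))// -RintD//; apply: le_Rint => //.
    exact: rintegrableD.
  move=> w; rewrite /stopped belowS indicI /= !indicE.
  have := V0 (n + m.+1) w.
  case: (boolP (w \in below _ _ _)) => _ /=; last by rewrite !mul0r; lra.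
  case: (boolP (w \in _)); rewrite ?(inE, notin_setE)/= ?mulr1; first lra.
  by move/negP; rewrite -leNgt; lra.
rewrite e1; lra.
Qed.

Definition exceeds (lam : R) (n : nat) : set T :=
  [set w | exists m, lam <= V (n + m) w].

Let exceedsE lam n : exceeds lam n = \bigcup_m ~` below lam n m.
Proof.
apply/seteqP; split=> w /=.
  by move=> [m h]; exists m => //= /(_ m (leqnn m)); rewrite ltNge h.
move=> [m _] /=; apply: contra_notP => h i _; rewrite ltNge; apply/negP => h2.
by apply: h; exists i.
Qed.

Lemma measurable_exceeds lam n : measurable (exceeds lam n).
Proof.
rewrite exceedsE; apply: bigcupT_measurable => m; apply: measurableC.
exact: (Gmeas (@below_adapted lam n m)).
Qed.

(** Off [below] the stopped process equals [lam], so Markov's inequality bounds every finite horizon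
    uniformly in m, and the horizons increase to [exceeds]. *)
Lemma maximal_inequality lam n : 0 < lam ->
  (P (exceeds lam n) <= (lam^-1 * (\int[P]_w V n w + C * tau n))%:E)%E.
Proof.
move=> lam0; set q := lam^-1 * _.
have mB m : measurable (below lam n m) by exact: (Gmeas (@below_adapted lam n m)).
have bound m : (P (~` below lam n m) <= q%:E)%E.
  have h := Rint_stopped n m (ltW lam0).
  have i1 : rintegrable P (fun w => \1_(~` below lam n m) w * 1).
    by apply: rintegrable_indic; [exact: measurableC|exact: rintegrable_cst].
  have : lam * \int[P]_w (\1_(~` below lam n m) w * 1) <= \int[P]_w stopped lam n m w.
    rewrite -RintZ//; apply: le_Rint => //; first exact: rintegrableZ.
    move=> w; rewrite /stopped !indicE in_setC.
    by have := V0 (n + m) w; case: (w \in _) => /=; lra.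
  rewrite Rint_indic; last exact: measurableC.
  rewrite Rintegral_cst ?mul1r; last exact: measurableC.
  have := mulr_ge0 C0 (tau0 (n + m)) => h1 h2.
  rewrite -[leLHS]fineK ?fin_num_measure//; last exact: measurableC.
  by rewrite lee_fin /q mulrC ler_pdivlMr// mulrC; lra.
have nd : nondecreasing_seq (fun m => ~` below lam n m).
  move=> m m' mm'; apply/subsetPset/subsetC => w h i im.
  exact/h/(leq_trans im).
have mC m : measurable (~` below lam n m) by exact: measurableC.
have cv := nondecreasing_cvg_mu (mu := P) mC (bigcupT_measurable _ mC) nd.
rewrite exceedsE -(cvg_lim _ cv)//.
by apply: lime_le; [apply/cvg_ex; eexists; exact: cv|exact: nearW].
Qed.

Let ae_never_of_small (A : nat -> set T) (N : set T) :
  (forall n, measurable (A n)) -> (forall n, N `<=` A n) ->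
  (forall e : R, 0 < e -> exists n, (P (A n) <= e%:E)%E) ->
  {ae P, forall w, ~ N w}.
Proof.
move=> mA NA hA.
exists (\bigcap_n A n); split.
- exact: bigcapT_measurable.
- apply/eqP; rewrite -measure_le0; apply/lee_addgt0Pr => e e0; rewrite add0e.
  have [n hn] := hA e e0; apply: le_trans hn.
  by apply: le_measure; rewrite ?inE; [exact: bigcapT_measurable|exact: mA|
    exact: bigcap_inf].
- by move=> w /= /contrapT Nw n _; exact: NA.
Qed.

Lemma ae_bounded_of_step : {ae P, forall w, exists B, forall k, V k w < B}.
Proof.
have H : {ae P, forall w, ~ [set w | forall j : nat, exceeds j.+1%:R 0 w] w}.
  apply: (@ae_never_of_small (fun j => exceeds j.+1%:R 0)).
  - by move=> j; exact: measurable_exceeds.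
  - by move=> j w; exact.
  move=> e e0; set q := \int[P]_w V 0%N w + C * tau 0%N.
  have [j hj] : exists j : nat, q / e < j.+1%:R.
    by exists (Num.truncn (q / e)); exact: truncnS_gt.
  exists j; apply: (le_trans (maximal_inequality 0 _)); first exact: ltr0Sn.
  rewrite lee_fin -/q mulrC ler_pdivrMr ?ltr0Sn//.
  by rewrite ltr_pdivrMr// mulrC in hj; exact: ltW.
apply: filterS H => w /= /existsNP[j hj].
exists j.+1%:R => k; rewrite ltNge; apply/negP => h.
by apply: hj; exists k.
Qed.

(** For each level 1/(j+1), exceeding it at some time from n on has a probability that a suitable n
    makes arbitrarily small; so almost surely some n exists after which the level is never
    reached. *)
Lemma ae_cvg0_of_step :
  (forall e : R, 0 < e -> exists n, \int[P]_w V n w + C * tau n <= e) ->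
  {ae P, forall w, V k w @[k --> \oo] --> (0 : R)}.
Proof.
move=> hV.
have H : {ae P, forall w, forall j : nat,
    ~ [set w | forall n, exceeds j.+1%:R^-1 n w] w}.
  apply: ae_foralln => j.
  apply: (@ae_never_of_small (fun n => exceeds j.+1%:R^-1 n)).
  - by move=> n; exact: measurable_exceeds.
  - by move=> n w; exact.
  move=> e e0; have j0 : 0 < j.+1%:R^-1 :> R by rewrite invr_gt0.
  have [n hn] := hV _ (mulr_gt0 j0 e0).
  exists n; apply: (le_trans (maximal_inequality n j0)).
  by rewrite lee_fin invrK -ler_pdivlMl// ltr0Sn.
apply: filterS H => w /= hw; apply/cvgrPdist_lt => e e0.
have [j] := ltr_add_invr e0; rewrite add0r => je.
have /existsNP[n hn] := hw j.
exists n => // k /= nk; rewrite sub0r normrN ger0_norm//.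
apply: lt_trans je; rewrite ltNge; apply/negP => h.
by apply: hn; exists (k - n)%N; rewrite subnKC.
Qed.

End MaximalInequality.

(** * The two-time-scale iteration *)

Section Filtration.
Context {disp : measure_display} {T : measurableType disp} {R : realType}.

Lemma open_coord_itv d (j : 'I_d) (a b : R) :
  open [set v : 'rV[R]_d | v 0 j \in `]a, b[].
Proof.
apply: (@open_comp _ _ (fun v : 'rV[R]_d => v 0 j) `]a, b[%classic).
  by move=> v _; exact: coord_continuous.
exact: interval_open.
Qed.

(** Kept apart from its closure because [g_sigma_algebraType] takes generators; the generated
    sigma-algebra unfolds to [noise_filtration]. *)
Definition noise_generators (d1 d2 : nat) (x0 : 'rV[R]_d1) (y0 : 'rV[R]_d2)
    (M : nat -> T -> 'rV[R]_d1) (M' : nat -> T -> 'rV[R]_d2) (k : nat) :=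
  preimage_borel (fun _ : T => x0) `|` preimage_borel (fun _ : T => y0) `|`
  \bigcup_(i in [set i | (1 <= i <= k)%N])
    (preimage_borel (M i) `|` preimage_borel (M' i)).

Context {d1 d2 : nat} (x0 : 'rV[R]_d1) (y0 : 'rV[R]_d2)
  (M : nat -> T -> 'rV[R]_d1) (M' : nat -> T -> 'rV[R]_d2)
  (hM : forall k, random_vector (M k.+1)) (hM' : forall k, random_vector (M' k.+1)).
Local Notation G := (noise_generators x0 y0 M M').

Lemma noise_generators_mono k A : <<s G k>> A -> <<s G k.+1>> A.
Proof.
apply: sub_sigma_algebra2 => B [h|[i /= /andP[i1 ik] h]]; first by left.
by right; exists i => //=; rewrite i1 leqW.
Qed.

Lemma noise_generators_measurable k A : <<s G k>> A -> measurable A.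
Proof.
apply: smallest_sub; first exact: sigma_algebra_measurable.
(* Index 0 is excluded by 1 <= i, which leaves the successors covered by [hM] and [hM']. *)
move=> B [[[U _ <-]|[U _ <-]]|[[//|i] _ [[U bU <-]|[U bU <-]]]].
- by rewrite preimage_cst; case: ifP.
- by rewrite preimage_cst; case: ifP.
- exact: hM.
- exact: hM'.
Qed.

Lemma noise_vmeas k :
  vmeas (M k.+1 : g_sigma_algebraType (G k.+1) -> 'rV[R]_d1) /\
  vmeas (M' k.+1 : g_sigma_algebraType (G k.+1) -> 'rV[R]_d2).
Proof.
have sub d (X : T -> 'rV[R]_d) : preimage_borel X `<=` G k.+1 ->
    vmeas (X : g_sigma_algebraType (G k.+1) -> 'rV[R]_d).
  move=> XG j; apply: (measurability _ (RGenOpens.measurableE R)) => //.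
  move=> _ [_ [a [b ->] <-]]; rewrite setTI.
  apply: sub_sigma_algebra; apply: XG.
  exists [set v : 'rV[R]_d | v 0 j \in `]a, b[] => //.
  by apply: sub_sigma_algebra; exact: open_coord_itv.
by split; apply: sub => B hB; right; exists k.+1 => /=;
  rewrite ?leqnn//; [left|right].
Qed.

End Filtration.

(** * Moments and convergence for abstract step-size sequences *)

Section Iteration.
Context {disp : measure_display} {T : measurableType disp} {R : realType}.
Context (P : probability T R) {d1 d2 : nat}.
Context (f : 'rV[R]_d1 -> 'rV[R]_d2 -> 'rV[R]_d1)
        (g : 'rV[R]_d1 -> 'rV[R]_d2 -> 'rV[R]_d2) (mu L c2 : R) (ys : 'rV[R]_d2).
Context (mu_ge0 : 0 <= mu) (mu_lt1 : mu < 1)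
  (hcontr : forall x1 x2 z, enorm (f x1 z - f x2 z) <= mu * enorm (x1 - x2))
  (hnonexp : forall y1 y2,
     enorm (g (xstar f y1) y1 - g (xstar f y2) y2) <= enorm (y1 - y2))
  (hys : Ystar f g ys) (hL : 0 < L)
  (hLip : forall x1 x2 y1 y2,
     enorm (f x1 y1 - f x2 y2) + enorm (g x1 y1 - g x2 y2)
       <= L * (enorm (x1 - x2) + enorm (y1 - y2))).
Context (al be tau : nat -> R)
  (al_gt0 : forall k, 0 < al k) (al_le : forall k, al k <= 2^-1)
  (be_gt0 : forall k, 0 < be k) (be_le : forall k, be k <= 2^-1)
  (be_al : forall k, be k ^+ 2 <= al k ^+ 3)
  (tau_ge0 : forall k, 0 <= tau k)
  (al_tau : forall k, al k ^+ 2 <= tau k - tau k.+1)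
  (al_succ : forall k, (1 - (1 - mu) / 2 * al k) * al k <= al k.+1)
  (be_succ : forall k, (1 - 1 / 2 * be k) * be k <= be k.+1).
Context (x0 : 'rV[R]_d1) (y0 : 'rV[R]_d2)
  (M : nat -> T -> 'rV[R]_d1) (M' : nat -> T -> 'rV[R]_d2)
  (x : nat -> T -> 'rV[R]_d1) (y : nat -> T -> 'rV[R]_d2).
Local Notation G := (noise_generators x0 y0 M M').
Local Notation L2 k := (adaptedL2 P (G k)).
Context
  (hx0 : forall w, x 0%N w = x0)
  (hy0 : forall w, y 0%N w = y0)
  (hx : forall k w, x k.+1 w =
     x k w + al k *: (f (x k w) (y k w) - x k w + M k.+1 w))
  (hy : forall k w, y k.+1 w =
     y k w + be k *: (g (x k w) (y k w) - y k w + M' k.+1 w))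
  (hMmeas : forall k, random_vector (M k.+1))
  (hM'meas : forall k, random_vector (M' k.+1))
  (hM : forall k, is_cond_exp_vec P (<<s G k>>) (M k.+1) (fun=> 0))
  (hM' : forall k, is_cond_exp_vec P (<<s G k>>) (M' k.+1) (fun=> 0))
  (hc2 : 0 < c2)
  (hvar : forall k, exists2 V : T -> \bar R,
     is_cond_exp P (<<s G k>>)
       (fun w => (enorm (M k.+1 w) ^+ 2 + enorm (M' k.+1 w) ^+ 2)%:E) V &
     {ae P, forall w, (V w <=
       (c2 * (1 + enorm (x k w) ^+ 2 + enorm (y k w) ^+ 2))%:E)%E}).

Let Gm k A : <<s G k>> A -> measurable A.
Proof. exact: noise_generators_measurable. Qed.

Let Gmono k A : <<s G k>> A -> <<s G k.+1>> A.
Proof. exact: noise_generators_mono. Qed.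

Let GT k : <<s G k>> setT.
Proof. exact: (@measurableT _ (g_sigma_algebraType (G k))). Qed.

Let L2S d k (X : T -> 'rV[R]_d) : L2 k X -> L2 k.+1 X.
Proof.
move=> [mX iX]; split=> // j _ A mA.
exact: noise_generators_mono (mX j measurableT A mA).
Qed.

Let L_ge0 : 0 <= L. Proof. exact: ltW. Qed.

Let Lmu_ge0 : 0 <= L / (1 - mu).
Proof. by rewrite divr_ge0// subr_ge0 ltW. Qed.

Let W k w := c2 * (1 + enorm (x k w) ^+ 2 + enorm (y k w) ^+ 2).
Let N k w := enorm (M k.+1 w) ^+ 2 + enorm (M' k.+1 w) ^+ 2.

Let W_integrable k : L2 k (x k) -> L2 k (y k) -> rintegrable P (W k).
Proof.
move=> [_ ix] [_ iy]; apply: rintegrableZ; apply: rintegrableD => //.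
by apply: rintegrableD => //; exact: rintegrable_cst.
Qed.

Let noise_facts k : L2 k (x k) -> L2 k (y k) ->
  [/\ rintegrable P (N k),
      forall B, <<s G k>> B ->
        \int[P]_(w in B) N k w <= \int[P]_(w in B) W k w,
      centered P (G k) (M k.+1) & centered P (G k) (M' k.+1)] /\
  L2 k.+1 (M k.+1) /\ L2 k.+1 (M' k.+1).
Proof.
move=> lx ly; have iW := W_integrable lx ly.
have [V hV VW] := hvar k.
have [||iN NW] := cond_exp_bound (@Gm k) hV VW _ _ iW.
- by move=> w; rewrite addr_ge0 ?sqr_ge0.
- move=> w; rewrite mulr_ge0 ?(ltW hc2)//.
  by rewrite !addr_ge0 ?sqr_ge0.
have [mM mM'] := noise_vmeas x0 y0 M M' k.
have sM := vmeas_sub (@Gm k.+1) mM; have sM' := vmeas_sub (@Gm k.+1) mM'.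
have iM : rintegrable P (fun w => enorm (M k.+1 w) ^+ 2).
  apply: (sqr_enorm_rintegrable_le sM _ iN) => w.
  by rewrite lerDl sqr_ge0.
have iM' : rintegrable P (fun w => enorm (M' k.+1 w) ^+ 2).
  apply: (sqr_enorm_rintegrable_le sM' _ iN) => w.
  by rewrite lerDr sqr_ge0.
have cen d (Z : T -> 'rV[R]_d) A j :
    is_cond_exp_vec P (<<s G k>>) Z (fun=> 0) -> <<s G k>> A ->
    \int[P]_(w in A) Z w 0 j = 0.
  move=> /(_ j)[_ [_ _ _ /(_ A)]] hA GA; rewrite /Rintegral -hA//.
  by under eq_integral do rewrite mxE; rewrite integral0.
split; last by split; split.
by split=> //; split=> // A j GA; exact: cen GA.
Qed.

Let fg_L2 k : L2 k (x k) -> L2 k (y k) ->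
  L2 k (fun w => f (x k w) (y k w)) /\ L2 k (fun w => g (x k w) (y k w)).
Proof.
move=> lx ly; split; apply: (adaptedL2_lipschitz2 (@Gm k) L_ge0) lx ly.
  by move=> u u' v v'; exact: f_lipschitz hLip _ _ _ _.
by move=> u u' v v'; exact: g_lipschitz hLip _ _ _ _.
Qed.

(** A bootstrap: square integrability of the iterates at k makes the variance bound integrable,
    hence the noise at k + 1, hence the iterates at k + 1. *)
Let xy_L2 k : L2 k (x k) /\ L2 k (y k).
Proof.
elim: k => [|k [lx ly]].
  split.
    by rewrite (_ : x 0%N = fun=> x0); [exact: adaptedL2_cst|exact/funext].
  by rewrite (_ : y 0%N = fun=> y0); [exact: adaptedL2_cst|exact/funext].
have [_ [lM lM']] := noise_facts lx ly.
have gm := @Gm k; have gm1 := @Gm k.+1.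
have [lf lg] := fg_L2 lx ly.
split.
  rewrite (_ : x k.+1 = fun w =>
     x k w + al k *: (f (x k w) (y k w) - x k w + M k.+1 w)); last exact/funext.
  apply: (adaptedL2D gm1); first exact: L2S.
  apply: (adaptedL2Z); apply: (adaptedL2D gm1) => //.
  by apply: L2S; exact: (adaptedL2B gm).
rewrite (_ : y k.+1 = fun w =>
   y k w + be k *: (g (x k w) (y k w) - y k w + M' k.+1 w)); last exact/funext.
apply: (adaptedL2D gm1); first exact: L2S.
apply: (adaptedL2Z); apply: (adaptedL2D gm1) => //.
by apply: L2S; exact: (adaptedL2B gm).
Qed.

Let x_L2 k : L2 k (x k). Proof. by case: (xy_L2 k). Qed.
Let y_L2 k : L2 k (y k). Proof. by case: (xy_L2 k). Qed.

Let f_L2 k : L2 k (fun w => f (x k w) (y k w)).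
Proof. by case: (fg_L2 (x_L2 k) (y_L2 k)). Qed.

Let g_L2 k : L2 k (fun w => g (x k w) (y k w)).
Proof. by case: (fg_L2 (x_L2 k) (y_L2 k)). Qed.

Let xs_L2 k : L2 k (fun w => xstar f (y k w)).
Proof.
apply: (adaptedL2_lipschitz (@Gm k) Lmu_ge0) (y_L2 k) => u u'.
exact: (xstar_lipschitz mu_ge0 mu_lt1 hcontr hLip).
Qed.

Let z k w := x k w - xstar f (y k w).
Let D k w := y k w - ys.

Let z_L2 k : L2 k (z k).
Proof. exact: (adaptedL2B (@Gm k)). Qed.

Let D_L2 k : L2 k (D k).
Proof. by apply: (adaptedL2B (@Gm k)) => //; exact: adaptedL2_cst. Qed.

Let z2 k w := enorm (z k w) ^+ 2.
Let D2 k w := enorm (D k w) ^+ 2.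
Let S k w := 1 + z2 k w + D2 k w.

Let z2_int k : rintegrable P (z2 k). Proof. by case: (z_L2 k). Qed.
Let D2_int k : rintegrable P (D2 k). Proof. by case: (D_L2 k). Qed.
Let S_int k : rintegrable P (S k).
Proof.
apply: rintegrableD => //; apply: rintegrableD => //; exact: rintegrable_cst.
Qed.

Let KW := c2 * growth_const f mu L ys.

Let W_le_S k w : W k w <= KW * S k w.
Proof.
rewrite -mulrA ler_wpM2l ?(ltW hc2)//.
exact: (growth_bound ys mu_ge0 mu_lt1 hcontr hL hLip).
Qed.

Let KW_ge0 : 0 <= KW.
Proof.
apply: mulr_ge0; first exact: ltW.
have h1 := sqr_ge0 (enorm ys); have h2 := sqr_ge0 (enorm (xstar f ys)).
by have h3 := sqr_ge0 (L / (1 - mu)); rewrite /growth_const; lra.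
Qed.

Let fast_const_ge0 : 0 <= fast_const mu L.
Proof.
have c0 : 0 < 1 - mu by rewrite subr_gt0.
rewrite addr_ge0// mulr_ge0 ?addr_ge0 ?divr_ge0 ?(ltW c0)//.
by rewrite mulr_ge0 ?sqr_ge0.
Qed.

Let Kz := fast_const mu L * (2 * L ^+ 2 + 8 + KW).

Let Kz_ge0 : 0 <= Kz.
Proof. by rewrite mulr_ge0// !addr_ge0// mulr_ge0 ?sqr_ge0. Qed.

Let z_step k B : <<s G k>> B ->
  \int[P]_(w in B) z2 k.+1 w <=
  (1 - 3 / 4 * (1 - mu) * al k) * \int[P]_(w in B) z2 k w +
  Kz * al k ^+ 2 * \int[P]_(w in B) S k w.
Proof.
move=> GB; have mB := Gm GB.
have [[iN NW cM cM'] _] := noise_facts (x_L2 k) (y_L2 k).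
have q0 : 0 <= fast_const mu L * al k ^+ 2 by rewrite mulr_ge0 ?sqr_ge0.
pose V w := (1 - 3 / 4 * (1 - mu) * al k) * z2 k w +
  fast_const mu L * al k ^+ 2 * enorm (g (x k w) (y k w) - y k w) ^+ 2.
have lh : L2 k (fun w => z k w + al k *: (f (x k w) (y k w) - x k w)).
  by apply: (adaptedL2D (@Gm k)) => //; apply: adaptedL2Z; exact: (adaptedL2B (@Gm k)).
have lg : L2 k (fun w => g (x k w) (y k w) - y k w) by exact: (adaptedL2B (@Gm k)).
have iV : rintegrable P V.
  by apply: rintegrableD; apply: rintegrableZ => //; case: lg.
(* In [fast_step] the slow noise enters only through its square, so its cross term is switched
   off. *)
have h0 := adaptedL2_cst P (G k) (0 : 'rV[R]_d2).
have H := cond_step (@Gm k) (r := 2 * al k) (r' := 0) q0 GB lh cM h0 cM' iV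
   (z2_int k.+1) iN (NW _ GB).
apply: (le_trans (H _)) => {H}.
  move=> w; rewrite /z2 /z hx hy mul0r addr0.
  have := fast_step mu_ge0 mu_lt1 hcontr hL hLip (x k w) (y k w) (M k.+1 w)
    (M' k.+1 w) (al_gt0 k) (al_le k) (be_gt0 k) (be_al k).
  by rewrite /V /z2 /z /N; lra.
have iW := W_integrable (x_L2 k) (y_L2 k).
rewrite -!RintZ// -!RintD//; try by apply: rintegrableZ.
apply: le_Rint => //; try by apply: rintegrableD => //; apply: rintegrableZ.
move=> w; rewrite /V.
have h1 := drift_bound hnonexp hys hL hLip (x k w) (y k w).
have h2 := W_le_S k w.
have p1 : 0 <= z2 k w := sqr_ge0 _.
have p2 : 0 <= D2 k w := sqr_ge0 _.
have p3 := mulr_ge0 (sqr_ge0 L) p2.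
have p4 := sqr_ge0 L.
have h3 : enorm (g (x k w) (y k w) - y k w) ^+ 2 + W k w <=
    (2 * L ^+ 2 + 8 + KW) * S k w.
  by move: h1 h2; rewrite -/(z k w) -/(D k w) -/(z2 k w) -/(D2 k w) /S; lra.
have := ler_wpM2l q0 h3; rewrite /Kz; lra.
Qed.

Let slow_const_ge0 : 0 <= slow_const mu L.
Proof.
have c0 : 0 < 1 - mu by rewrite subr_gt0.
by rewrite addr_ge0 ?sqr_ge0// divr_ge0 ?(ltW c0)// mulr_ge0 ?sqr_ge0.
Qed.

Let D_step k B : <<s G k>> B ->
  \int[P]_(w in B) D2 k.+1 w <=
  \int[P]_(w in B) D2 k w + (1 - mu) / 4 * al k * \int[P]_(w in B) z2 k w +
  (slow_const mu L + KW) * al k ^+ 2 * \int[P]_(w in B) S k w.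
Proof.
move=> GB; have mB := Gm GB.
have [[iN NW cM cM'] _] := noise_facts (x_L2 k) (y_L2 k).
have q0 : 0 <= al k ^+ 2 by exact: sqr_ge0.
pose V w := D2 k w + (1 - mu) / 4 * al k * z2 k w +
  slow_const mu L * al k ^+ 2 * (z2 k w + D2 k w).
have lh : L2 k (fun w => D k w + be k *: (g (x k w) (y k w) - y k w)).
  by apply: (adaptedL2D (@Gm k)) => //; apply: adaptedL2Z; exact: (adaptedL2B (@Gm k)).
have iV : rintegrable P V.
  apply: rintegrableD; first by apply: rintegrableD => //; exact: rintegrableZ.
  by apply: rintegrableZ; exact: rintegrableD.
have h0 := adaptedL2_cst P (G k) (0 : 'rV[R]_d1).
have H := cond_step (@Gm k) (r := 0) (r' := 2 * be k) q0 GB h0 cM lh cM' iV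
   (D2_int k.+1) iN (NW _ GB).
apply: (le_trans (H _)) => {H}.
  move=> w; rewrite /D2 /D hy mul0r addr0.
  have := slow_step mu_lt1 hnonexp hys hL hLip (x k w) (y k w)
    (M' k.+1 w) (al_gt0 k) (al_le k) (be_gt0 k) (be_le k) (be_al k).
  have := mulr_ge0 q0 (sqr_ge0 (enorm (M k.+1 w))).
  by rewrite /V /z2 /z /D2 /D /N; lra.
have iW := W_integrable (x_L2 k) (y_L2 k).
rewrite -!RintZ// -!RintD//; try by apply: rintegrableZ.
  apply: le_Rint => //.
  - by apply: rintegrableD => //; exact: rintegrableZ.
  - apply: rintegrableD; last exact: rintegrableZ.
    by apply: rintegrableD => //; exact: rintegrableZ.
  move=> w; rewrite /V.
  have h2 := ler_wpM2l q0 (W_le_S k w).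
  have p4 := mulr_ge0 slow_const_ge0 q0; rewrite /S in h2 *; lra.
by apply: rintegrableD => //; exact: rintegrableZ.
Qed.

(** In the sum of [z_step] and [D_step], the gain 3/4 (1 - mu) al covers the loss 1/4 (1 - mu) al,
    which leaves the growth factor 1 + K al^2. *)
Let moments_bounded : exists2 B, 0 < B & forall k, \int[P]_w S k w <= B.
Proof.
pose v k := \int[P]_w z2 k w + \int[P]_w D2 k w.
have SE k : \int[P]_w S k w = 1 + v k.
  rewrite RintD//; last by apply: rintegrableD => //; exact: rintegrable_cst.
  rewrite RintD//; last exact: rintegrable_cst.
  by rewrite Rint_cst /v addrA.
pose K := Kz + (slow_const mu L + KW).
have K0 : 0 <= K by apply: addr_ge0 => //; exact: addr_ge0.
have v0 k : 0 <= v k.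
  by rewrite addr_ge0//; apply: Rintegral_ge0 => w _; exact: sqr_ge0.
have vS k : v k.+1 <= (1 + K * al k ^+ 2) * v k + K * al k ^+ 2.
  have h1 := z_step (@GT k); have h2 := D_step (@GT k).
  rewrite SE in h1 h2.
  have a0 := al_gt0 k; have c0 : 0 < 1 - mu by rewrite subr_gt0.
  have p : 0 <= \int[P]_w z2 k w by apply: Rintegral_ge0 => w _; exact: sqr_ge0.
  have := mulr_ge0 (mulr_ge0 (ltW c0) (ltW a0)) p.
  move: h1 h2 p; rewrite /v /K.
  move: (Rintegral _ _ (z2 k.+1)) (Rintegral _ _ (D2 k.+1)) => i1 i2.
  move: (Rintegral _ _ (z2 k)) (Rintegral _ _ (D2 k)) => i3 i4.
  by move: Kz (slow_const mu L) => K1 K2; lra.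
have [B B0 vB] := bounded_recursion K0 tau_ge0 v0 al_tau vS.
by exists (1 + B) => [|k]; [lra|rewrite SE lerD2l].
Qed.

Let z_rate : exists2 C, 0 < C & forall k, \int[P]_w z2 k w <= C * al k.
Proof.
have [B B0 SB] := moments_bounded.
have c0 : 0 < 1 - mu by rewrite subr_gt0.
have C0 : 0 <= Kz * B by rewrite mulr_ge0// ltW.
apply: (rate_recursion c0 C0 al_gt0 _ al_succ) => k.
  have a0 := al_gt0 k; have a1 := al_le k.
  have : (1 - mu) * al k <= al k by rewrite ler_piMl ?(ltW a0)// gerBl.
  by lra.
apply: (le_trans (z_step (@GT k))); rewrite lerD2l.
have := ler_wpM2l (mulr_ge0 Kz_ge0 (sqr_ge0 (al k))) (SB k); lra.
Qed.

(* Averaged noise; subtracting it from y leaves an inexact Krasnoselskii-Mann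
   iteration whose error is small in mean square. *)
Let U := fix U (k : nat) (w : T) : 'rV[R]_d2 :=
  if k is k'.+1 then (1 - be k') *: U k' w + be k' *: M' k w else 0.

Let U_L2 k : L2 k (U k).
Proof.
elim: k => [|k IH]; first exact: adaptedL2_cst.
have [_ [_ lM']] := noise_facts (x_L2 k) (y_L2 k).
apply: (adaptedL2D (@Gm k.+1)); apply: adaptedL2Z => //; exact: L2S.
Qed.

Let U2 k w := enorm (U k w) ^+ 2.
Let U2_int k : rintegrable P (U2 k). Proof. by case: (U_L2 k). Qed.

Let U_step k B : <<s G k>> B ->
  \int[P]_(w in B) U2 k.+1 w <=
  (1 - be k) ^+ 2 * \int[P]_(w in B) U2 k w +
  KW * be k ^+ 2 * \int[P]_(w in B) S k w.
Proof.
move=> GB; have mB := Gm GB.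
have [[iN NW cM cM'] _] := noise_facts (x_L2 k) (y_L2 k).
have q0 : 0 <= be k ^+ 2 by exact: sqr_ge0.
have iV : rintegrable P (fun w => (1 - be k) ^+ 2 * U2 k w) by exact: rintegrableZ.
have h0 := adaptedL2_cst P (G k) (0 : 'rV[R]_d1).
have H := cond_step (@Gm k) (r := 0) (r' := 2 * (1 - be k) * be k) q0 GB h0 cM
  (U_L2 k) cM' iV (U2_int k.+1) iN (NW _ GB).
apply: (le_trans (H _)) => {H}.
  move=> w; rewrite /U2 /= sqr_enormD !enormZ !exprMn !real_normK ?num_real//.
  rewrite dotvZl dotvZr mul0r addr0 /N.
  by have := mulr_ge0 q0 (sqr_ge0 (enorm (M k.+1 w))); lra.
have iW := W_integrable (x_L2 k) (y_L2 k).
rewrite RintZ// lerD2l -!RintZ//; apply: le_Rint => //; try exact: rintegrableZ.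
by move=> w; have := ler_wpM2l q0 (W_le_S k w); lra.
Qed.

Let be_le_al k : be k <= al k.
Proof.
have a0 := al_gt0 k; have a1 := al_le k; have b0 := be_gt0 k; have h := be_al k.
rewrite -(@ler_pXn2r _ 2) ?nnegrE ?(ltW a0) ?(ltW b0)//.
have := ler_wpM2r (sqr_ge0 (al k)) a1; have := sqr_ge0 (al k); lra.
Qed.

Let U_rate : exists2 C, 0 < C & forall k, \int[P]_w U2 k w <= C * be k.
Proof.
have [B B0 SB] := moments_bounded.
have C0 : 0 <= KW * B by rewrite mulr_ge0// ltW.
apply: (rate_recursion ltr01 C0 be_gt0 _ be_succ) => k.
  by have := be_le k; lra.
apply: (le_trans (U_step (@GT k))).
have u0 : 0 <= \int[P]_w U2 k w by apply: Rintegral_ge0 => w _; exact: sqr_ge0.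
have b0 := be_gt0 k; have b1 := be_le k.
have h1 := ler_wpM2l (mulr_ge0 KW_ge0 (sqr_ge0 (be k))) (SB k).
have h2 : (1 - be k) ^+ 2 <= 1 - 3 / 4 * 1 * be k by nra.
have h3 := ler_wpM2r u0 h2.
lra.
Qed.

Let yt k w := y k w - U k w.

(** [U] relaxes with the same step [be k] as [y], so [M'] cancels exactly. *)
Let ytS k w : yt k.+1 w = yt k w + be k *: (g (x k w) (y k w) - yt k w).
Proof. by rewrite /yt hy /=; apply/rowP => i; rewrite !mxE; ring. Qed.

Let y_sub_yt k w : y k w - yt k w = U k w.
Proof. by rewrite /yt subKr. Qed.

Let yt_L2 k : L2 k (yt k).
Proof. exact: (adaptedL2B (@Gm k)). Qed.

Let gbar v := g (xstar f v) v.
Let r2 k w := enorm (gbar (yt k w) - yt k w) ^+ 2.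
Let A2 k w := enorm (yt k w - ys) ^+ 2.
Let E2 k w := enorm (g (x k w) (y k w) - gbar (yt k w)) ^+ 2.

Let gbar_L2 k : L2 k (fun w => gbar (yt k w)).
Proof.
apply: (adaptedL2_lipschitz (@Gm k) ler01) (yt_L2 k) => u u'.
by rewrite mul1r; exact: hnonexp.
Qed.

Let r2_int k : rintegrable P (r2 k).
Proof. by have [] := adaptedL2B (@Gm k) (gbar_L2 k) (yt_L2 k). Qed.

Let A2_int k : rintegrable P (A2 k).
Proof. by have [] := adaptedL2B (@Gm k) (yt_L2 k) (adaptedL2_cst P (G k) ys). Qed.

Let E2_int k : rintegrable P (E2 k).
Proof. by have [] := adaptedL2B (@Gm k) (g_L2 k) (gbar_L2 k). Qed.

Let error_rate : exists2 C, 0 < C & forall k, \int[P]_w E2 k w <= C * al k.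
Proof.
have [Cz Cz0 hz] := z_rate; have [Cu Cu0 hu] := U_rate.
have p4 := sqr_ge0 L.
exists (2 * L ^+ 2 * Cz + 2 * Cu).
  by have := mulr_ge0 p4 (ltW Cz0); lra.
move=> k.
apply: (@le_trans _ _ (\int[P]_w (2 * L ^+ 2 * z2 k w + 2 * U2 k w))).
  apply: le_Rint => //; first by apply: rintegrableD; exact: rintegrableZ.
  move=> w; have := slow_error_bound hnonexp hL hLip (x k w) (y k w) (yt k w).
  by rewrite y_sub_yt.
rewrite RintD ?RintZ//; try exact: rintegrableZ.
have h1 := ler_wpM2l (mulr_ge0 (ler0n R 2) p4) (hz k).
have h2 := hu k; have h3 := ler_wpM2l (ltW Cu0) (be_le_al k).
lra.
Qed.

(** [residual_step] holds pointwise, since no noise is left. The error over B is enlarged to its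
    full mean, giving the additive form required by the maximal inequality. *)
Let r_step k B : <<s G k>> B ->
  \int[P]_(w in B) r2 k.+1 w <=
  \int[P]_(w in B) r2 k w + 2 * be k * \int[P]_w E2 k w.
Proof.
move=> GB; have mB := Gm GB.
have b0 : 0 <= 2 * be k by rewrite mulr_ge0// ltW.
apply: (@le_trans _ _ (\int[P]_(w in B) (r2 k w + 2 * be k * E2 k w))).
  apply: le_Rint => //; first by apply: rintegrableD => //; exact: rintegrableZ.
  by move=> w; exact: (residual_step hnonexp (be_gt0 k) (be_le k) (ytS k w)).
rewrite RintD//; last exact: rintegrableZ.
rewrite lerD2l RintZ// ler_wpM2l// Rint_subset// => w; exact: sqr_ge0.
Qed.

Let anchor_bounded : exists2 C, 0 < C & forall k, \int[P]_w A2 k w <= C.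
Proof.
have [B B0 SB] := moments_bounded; have [Cu Cu0 hu] := U_rate.
exists (2 * B + Cu); first lra.
move=> k.
apply: (@le_trans _ _ (\int[P]_w (2 * S k w + 2 * U2 k w))).
  apply: le_Rint => //; first by apply: rintegrableD; exact: rintegrableZ.
  move=> w; have := sqr_enormD_le2 (D k w) (-1 *: U k w).
  rewrite enormZ normrN1 mul1r scaleN1r.
  have -> : D k w - U k w = yt k w - ys.
    by rewrite /D /yt; apply/rowP => i; rewrite !mxE; ring.
  have p1 : 0 <= z2 k w := sqr_ge0 _.
  by rewrite /A2 /S /D2 /U2; lra.
rewrite RintD ?RintZ//; try exact: rintegrableZ.
have h1 := SB k; have h2 := hu k.
by have h3 := ler_wpM2l (ltW Cu0) (be_le k); lra.
Qed.

(** The factor 1 + al^2 becomes an additive error because [A2] has bounded mean, and [error_rate]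
    makes 2 al E2 of order al^2 as well. *)
Let A_step : exists2 C, 0 < C & forall k B, <<s G k>> B ->
  \int[P]_(w in B) A2 k.+1 w + be k / 2 * \int[P]_(w in B) r2 k w <=
  \int[P]_(w in B) A2 k w + C * al k ^+ 2.
Proof.
have [Ca Ca0 ha] := anchor_bounded; have [Ce Ce0 he] := error_rate.
exists (Ca + 2 * Ce) => [|k B GB]; first lra.
have mB := Gm GB; have a0 := al_gt0 k.
have hB : \int[P]_(w in B) A2 k w <= Ca.
  by apply: le_trans (ha k); apply: Rint_subset => // w; exact: sqr_ge0.
have eB : \int[P]_(w in B) E2 k w <= Ce * al k.
  by apply: le_trans (he k); apply: Rint_subset => // w; exact: sqr_ge0.
have : \int[P]_(w in B) (A2 k.+1 w + be k / 2 * r2 k w) <=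
    \int[P]_(w in B) ((1 + al k ^+ 2) * A2 k w + 2 * al k * E2 k w).
  apply: le_Rint => //.
  - by apply: rintegrableD => //; exact: rintegrableZ.
  - by apply: rintegrableD; exact: rintegrableZ.
  move=> w; rewrite /A2 ytS.
  have := km_step hnonexp hys (yt k w) (g (x k w) (y k w)) (al_gt0 k) (al_le k)
    (be_gt0 k) (be_le k) (be_al k).
  by rewrite /r2 /E2 /gbar; lra.
rewrite !RintD ?RintZ//; try exact: rintegrableZ.
have h1 := ler_wpM2l (sqr_ge0 (al k)) hB.
have h2 := ler_wpM2l (ltW a0) eB.
move: h1 h2; move: (Rintegral _ _ (A2 k.+1)) (Rintegral _ _ (r2 k)) => i1 i2.
move: (Rintegral _ _ (A2 k)) (Rintegral _ _ (E2 k)) => i3 i4.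
lra.
Qed.

(** * Rate of the slow residual under a weight growing at most like the sums of [be] *)

Context (wt : nat -> R) (Cw : R) (Cw_ge0 : 0 <= Cw)
  (wt_gt0 : forall k, 0 < wt k)
  (wt_succ : forall k, wt k.+1 <= wt k + Cw * be k)
  (wt_al : forall k, wt k * be k * al k <= Cw * al k ^+ 2).

Let r2_rate : exists2 C, 0 < C & forall k, \int[P]_w r2 k w <= C / wt k.
Proof.
have [Ce Ce0 he] := error_rate; have [Ca Ca0 hA] := A_step.
pose X k := wt k * \int[P]_w r2 k w + 2 * Cw * \int[P]_w A2 k w.
pose K := 4 * Ce * Cw + 2 * Cw * Ca.
have Cw0 := Cw_ge0.
have K0 : 0 <= K.
  by have := mulr_ge0 (ltW Ce0) Cw0; have := mulr_ge0 Cw0 (ltW Ca0); rewrite /K; lra.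
have r0 k : 0 <= \int[P]_w r2 k w by apply: Rintegral_ge0 => w _; exact: sqr_ge0.
have a0 k : 0 <= \int[P]_w A2 k w by apply: Rintegral_ge0 => w _; exact: sqr_ge0.
have XS k : X k.+1 <= X k + K * (tau k - tau k.+1).
  apply: (@le_trans _ _ (X k + K * al k ^+ 2)); last first.
    by rewrite lerD2l; exact: ler_wpM2l.
  rewrite /X /K.
  have h1 := r_step (@GT k); have h2 := he k; have h3 := hA k _ (@GT k).
  have w1 := wt_succ k; have w2 := wt_al k.
  exact: (weighted_step Cw0 (ltW Ce0) (wt_gt0 k) (al_gt0 k) (al_le k) (be_gt0 k)
    (be_le_al k) (r0 k.+1) w1 w2 h1 h2 h3).
have XB := telescope_le K0 tau_ge0 XS.
exists (`|X 0 + K * tau 0| + 1); first by rewrite ltr_wpDl.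
move=> k; rewrite ler_pdivlMr// mulrC.
apply: (@le_trans _ _ (X k)).
  by rewrite lerDl; apply: mulr_ge0 => //; exact: mulr_ge0.
by rewrite (le_trans (XB k))// (le_trans (ler_norm _))// lerDl.
Qed.

Let ry2 k w := enorm (gbar (y k w) - y k w) ^+ 2.

Let ry2_int k : rintegrable P (ry2 k).
Proof.
have l1 : L2 k (fun w => gbar (y k w)).
  apply: (adaptedL2_lipschitz (@Gm k) ler01) (y_L2 k) => u u'.
  by rewrite mul1r; exact: hnonexp.
by have [] := adaptedL2B (@Gm k) l1 (y_L2 k).
Qed.

Lemma mean_square_rates : exists2 C, 0 < C & forall k,
  [/\ rintegrable P (fun w => enorm (x k w - xstar f (y k w)) ^+ 2),
      \int[P]_w (enorm (x k w - xstar f (y k w)) ^+ 2) <= C * al k,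
      rintegrable P (fun w => enorm (g (xstar f (y k w)) (y k w) - y k w) ^+ 2) &
      \int[P]_w (enorm (g (xstar f (y k w)) (y k w) - y k w) ^+ 2) <=
        C * ((wt k)^-1 + be k)].
Proof.
have [Cz Cz0 hz] := z_rate; have [Cu Cu0 hu] := U_rate.
have [Cr Cr0 hr] := r2_rate.
exists (Cz + 2 * Cr + 8 * Cu); first lra.
move=> k; have a0 := al_gt0 k; have b0 := be_gt0 k.
have w0 : 0 < (wt k)^-1 by rewrite invr_gt0.
split; [exact: z2_int| |exact: ry2_int|].
  apply: (le_trans (hz k)); rewrite ler_wpM2r ?(ltW a0)//; lra.
apply: (@le_trans _ _ (\int[P]_w (2 * r2 k w + 8 * U2 k w))).
  apply: le_Rint; [by []|exact: ry2_int| |].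
    by apply: rintegrableD; exact: rintegrableZ.
  move=> w; have h := residual_lipschitz hnonexp (y k w) (yt k w).
  rewrite y_sub_yt -/(gbar _) -/(gbar _) in h.
  apply: (@le_trans _ _ ((enorm (gbar (yt k w) - yt k w) + 2 * enorm (U k w)) ^+ 2)).
    by rewrite ler_pXn2r ?nnegrE ?addr_ge0 ?mulr_ge0 ?enorm_ge0.
  have := sqr_ge0 (enorm (gbar (yt k w) - yt k w) - 2 * enorm (U k w)).
  by rewrite /r2 /U2; lra.
rewrite RintD ?RintZ//; try exact: rintegrableZ.
have h1 := hr k; have h2 := hu k.
have := mulr_gt0 Cz0 w0; have := mulr_gt0 Cz0 b0; have := mulr_gt0 Cr0 b0.
have := mulr_gt0 Cu0 w0.
lra.
Qed.

(** * Almost sure convergence *)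

Context (tau_cvg : tau k @[k --> \oo] --> (0 : R))
  (wt_cvg : (wt k)^-1 @[k --> \oo] --> (0 : R)).

Let sqr_cvg0 (u : nat -> R) : (forall k, 0 <= u k) ->
  u k ^+ 2 @[k --> \oo] --> (0 : R) -> u k @[k --> \oo] --> (0 : R).
Proof.
move=> u0 /cvgrPdist_lt h; apply/cvgrPdist_lt => e e0.
have := h (e ^+ 2) (exprn_gt0 _ e0); apply: filterS => k.
rewrite !sub0r !normrN !ger0_norm ?sqr_ge0// => uk.
by rewrite -(@ltr_pXn2r _ 2) ?nnegrE ?(ltW e0).
Qed.

Let le_cvg0 (u v : nat -> R) : (forall k, 0 <= u k) -> (forall k, u k <= v k) ->
  v k @[k --> \oo] --> (0 : R) -> u k @[k --> \oo] --> (0 : R).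
Proof.
move=> u0 uv vc; apply: (squeeze_cvgr _ (cvg_cst 0) vc).
by apply: nearW => k; rewrite u0 uv.
Qed.

Let al_cvg : al k @[k --> \oo] --> (0 : R).
Proof.
apply: sqr_cvg0 => [k|]; first exact: ltW.
apply: (le_cvg0 _ _ tau_cvg) => k; first exact: sqr_ge0.
by apply: (le_trans (al_tau k)); rewrite gerBl.
Qed.

Let small_of_rate (v u : nat -> R) (C C' : R) :
  (forall k, v k <= C * u k) -> u k @[k --> \oo] --> (0 : R) ->
  forall e : R, 0 < e -> exists n, v n + C' * tau n <= e.
Proof.
move=> vu uc e e0.
have : C * u k + C' * tau k @[k --> \oo] --> (0 : R).
  rewrite -(addr0 0) -[X in _ --> X + _](mulr0 C) -[X in _ --> _ + X](mulr0 C').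
  by apply: cvgD; apply: cvgM => //; exact: cvg_cst.
move=> /cvgrPdist_lt /(_ e e0) [n _ /(_ n (leqnn n))] /=.
rewrite sub0r normrN => h; exists n; have := vu n.
have := ler_norm (C * u n + C' * tau n).
lra.
Qed.

(** The contraction is discarded and [S] replaced by its mean bound, leaving a summable additive
    error; that the means vanish comes from [z_rate]. *)
Let z_as : {ae P, forall w, enorm (z k w) @[k --> \oo] --> (0 : R)}.
Proof.
have [B B0 SB] := moments_bounded; have [Cz Cz0 hz] := z_rate.
have C0 : 0 <= Kz * B by rewrite mulr_ge0// ltW.
apply: filterS (ae_cvg0_of_step Gm Gmono (fun _ _ => sqr_ge0 _) z2_int
  (fun k => measurable_sqr_enorm (proj1 (z_L2 k))) C0 tau_ge0 _
  (small_of_rate _ hz al_cvg)) => [w zw|k A GA].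
  by apply: sqr_cvg0 => // k; exact: enorm_ge0.
have mA := Gm GA.
apply: (le_trans (z_step GA)); apply: lerD.
  have p : 0 <= \int[P]_(w in A) z2 k w.
    by apply: Rintegral_ge0 => w _; exact: sqr_ge0.
  have q : 0 <= 3 / 4 * (1 - mu) * al k.
    by rewrite !mulr_ge0// ?(ltW (al_gt0 k))// subr_ge0 ltW.
  by rewrite ler_piMl// gerBl.
have h : \int[P]_(w in A) S k w <= B.
  apply: le_trans (SB k); apply: Rint_subset => // w.
  by rewrite !addr_ge0// sqr_ge0.
have h1 := ler_wpM2l (mulr_ge0 Kz_ge0 (sqr_ge0 (al k))) h.
by apply: (le_trans h1); rewrite mulrAC; exact: ler_wpM2l.
Qed.

Let U_as : {ae P, forall w, enorm (U k w) @[k --> \oo] --> (0 : R)}.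
Proof.
have [B B0 SB] := moments_bounded; have [Cu Cu0 hu] := U_rate.
have C0 : 0 <= KW * B by rewrite mulr_ge0// ltW.
have be_cvg : be k @[k --> \oo] --> (0 : R).
  by apply: (le_cvg0 _ be_le_al al_cvg) => k; exact: ltW.
apply: filterS (ae_cvg0_of_step Gm Gmono (fun _ _ => sqr_ge0 _) U2_int
  (fun k => measurable_sqr_enorm (proj1 (U_L2 k))) C0 tau_ge0 _
  (small_of_rate _ hu be_cvg)) => [w zw|k A GA].
  by apply: sqr_cvg0 => // k; exact: enorm_ge0.
have mA := Gm GA.
apply: (le_trans (U_step GA)); apply: lerD.
  have p : 0 <= \int[P]_(w in A) U2 k w.
    by apply: Rintegral_ge0 => w _; exact: sqr_ge0.
  have b0 := be_gt0 k; have b1 := be_le k.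
  by rewrite ler_piMl//; nra.
have h : \int[P]_(w in A) S k w <= B.
  apply: le_trans (SB k); apply: Rint_subset => // w.
  by rewrite !addr_ge0// sqr_ge0.
have h1 := ler_wpM2l (mulr_ge0 KW_ge0 (sqr_ge0 (be k))) h.
apply: (le_trans h1); rewrite mulrAC; apply: ler_wpM2l => //.
apply: le_trans (al_tau k).
by rewrite ler_pXn2r ?nnegrE ?(ltW (al_gt0 k)) ?(ltW (be_gt0 k)).
Qed.

Let r_as : {ae P, forall w,
  enorm (gbar (yt k w) - yt k w) @[k --> \oo] --> (0 : R)}.
Proof.
have [Ce Ce0 he] := error_rate; have [Cr Cr0 hr] := r2_rate.
have C0 : 0 <= 2 * Ce by rewrite mulr_ge0// ltW.
apply: filterS (ae_cvg0_of_step Gm Gmono (fun _ _ => sqr_ge0 _) r2_int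
  (fun k => measurable_sqr_enorm
    (proj1 (adaptedL2B (@Gm k) (gbar_L2 k) (yt_L2 k)))) C0 tau_ge0 _
  (small_of_rate _ hr wt_cvg)) => [w zw|k A GA].
  by apply: sqr_cvg0 => // k; exact: enorm_ge0.
apply: (le_trans (r_step GA)); rewrite lerD2l.
apply: (@le_trans _ _ (2 * Ce * al k ^+ 2)); last exact: ler_wpM2l.
have e0 : 0 <= \int[P]_w E2 k w by apply: Rintegral_ge0 => w _; exact: sqr_ge0.
have -> : 2 * Ce * al k ^+ 2 = (2 * al k) * (Ce * al k) by ring.
apply: ler_pM => //; first by rewrite mulr_ge0// ltW.
by rewrite ler_wpM2l.
Qed.

Let yt_bounded : {ae P, forall w, exists B, forall k, A2 k w < B}.
Proof.
have [Ca Ca0 hA] := A_step.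
apply: (ae_bounded_of_step Gm Gmono (fun _ _ => sqr_ge0 _) A2_int
  (fun k => measurable_sqr_enorm
    (proj1 (adaptedL2B (@Gm k) (yt_L2 k) (adaptedL2_cst P (G k) ys))))
  (ltW Ca0) tau_ge0) => k A GA.
have r0 : 0 <= \int[P]_(w in A) r2 k w by apply: Rintegral_ge0 => w _; exact: sqr_ge0.
have p := mulr_ge0 (divr_ge0 (ltW (be_gt0 k)) (ler0n R 2)) r0.
apply: (@le_trans _ _ (\int[P]_(w in A) A2 k w + Ca * al k ^+ 2)).
  by apply: le_trans (hA k A GA); rewrite lerDl.
by rewrite lerD2l ler_wpM2l// ltW.
Qed.

Lemma almost_sure_convergence : {ae P, forall w,
  enorm (x k w - xstar f (y k w)) @[k --> \oo] --> (0 : R) /\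
  edist_set (y k w) (Ystar f g) @[k --> \oo] --> (0 : R)}.
Proof.
apply: filterS2 (filterI z_as U_as) (filterI r_as yt_bounded).
move=> w [zw Uw] [rw [B hB]]; split => //.
have Y0 : Ystar f g !=set0 by exists ys.
(* The inequality t <= 1 + t^2 avoids a square root of B. *)
have ytB k : enorm (yt k w) <= B + 1 + enorm ys.
  have := ler_enormD (yt k w - ys) ys; rewrite subrK => h.
  have := hB k; rewrite /A2 => h2.
  have := sqr_ge0 (enorm (yt k w - ys) - 1); have := sqr_ge0 (enorm (yt k w - ys)).
  lra.
have gl u v : enorm (gbar u - gbar v) <= 1 * enorm (u - v).
  by rewrite mul1r; exact: hnonexp.
have dw := residual_cvg_dist (G := gbar) Y0 gl ytB rw.
have : enorm (U k w) + edist_set (yt k w) (Ystar f g) @[k --> \oo] --> (0 : R).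
  by rewrite -(addr0 0); exact: cvgD.
apply: le_cvg0 => k; first exact: edist_set_ge0.
by rewrite -y_sub_yt; exact: edist_set_lipschitz.
Qed.

End Iteration.

(** * Polynomial step sizes *)

Unset Implicit Arguments.
Set Strict Implicit.

Theorem theorem2p6 (R : realType) (disp : measure_display)
  (Omega : measurableType disp) (P : probability Omega R) (d1 d2 : nat)
  (f : 'rV[R]_d1 -> 'rV[R]_d2 -> 'rV[R]_d1)
  (g : 'rV[R]_d1 -> 'rV[R]_d2 -> 'rV[R]_d2)
  (x0 : 'rV[R]_d1) (y0 : 'rV[R]_d2)
  (M : nat -> Omega -> 'rV[R]_d1) (M' : nat -> Omega -> 'rV[R]_d2)
  (x : nat -> Omega -> 'rV[R]_d1) (y : nat -> Omega -> 'rV[R]_d2)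
  (mu L c1 c2 alpha beta a b K1 : R)
  (* (i) contraction *)
  (hmu : 0 <= mu < 1)
  (hcontr : forall x1 x2 z,
     enorm (f x1 z - f x2 z) <= mu * enorm (x1 - x2))
  (* (ii) non-expansiveness *)
  (hnonexp : forall y1 y2,
     enorm (g (xstar f y1) y1 - g (xstar f y2) y2) <= enorm (y1 - y2))
  (hYstar : Ystar f g !=set0)
  (* (iii) Lipschitz continuity and linear growth *)
  (hL : 0 < L) (hc1 : 0 < c1)
  (hLip : forall x1 x2 y1 y2,
     enorm (f x1 y1 - f x2 y2) + enorm (g x1 y1 - g x2 y2)
       <= L * (enorm (x1 - x2) + enorm (y1 - y2)))
  (hgrowth : forall u v,
     enorm (f u v) + enorm (g u v) <= c1 * (1 + enorm u + enorm v))
  (* the iteration *)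
  (hx0 : forall w, x 0%N w = x0)
  (hy0 : forall w, y 0%N w = y0)
  (hx : forall k w, x k.+1 w =
     x k w + stepsize alpha a K1 k *: (f (x k w) (y k w) - x k w + M k.+1 w))
  (hy : forall k w, y k.+1 w =
     y k w + stepsize beta b K1 k *: (g (x k w) (y k w) - y k w + M' k.+1 w))
  (* (iv) noise *)
  (hMmeas : forall k, random_vector (M k.+1))
  (hM'meas : forall k, random_vector (M' k.+1))
  (hM : forall k,
     is_cond_exp_vec P (noise_filtration x0 y0 M M' k) (M k.+1) (fun=> 0))
  (hM' : forall k,
     is_cond_exp_vec P (noise_filtration x0 y0 M M' k) (M' k.+1) (fun=> 0))
  (hc2 : 0 < c2)
  (hvar : forall k, exists2 V : Omega -> \bar R,
     is_cond_exp P (noise_filtration x0 y0 M M' k)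
       (fun w => (enorm (M k.+1 w) ^+ 2 + enorm (M' k.+1 w) ^+ 2)%:E) V &
     {ae P, forall w, (V w <=
       (c2 * (1 + enorm (x k w) ^+ 2 + enorm (y k w) ^+ 2))%:E)%E})
  (* (v) step sizes *)
  (ha : 2^-1 < a) (hab : a < b) (hb : b < 1)
  (halpha : 0 < alpha <= 2^-1) (hbeta : 0 < beta <= 2^-1)
  (hK1 : 1 <= K1)
  (hratio : forall k,
     stepsize beta b K1 k ^+ 2 / stepsize alpha a K1 k ^+ 3 <= 1)
  (* additional conditions *)
  (hgamma1 : beta / alpha <= gamma1 mu L)
  (hgamma2 : gamma2 mu alpha beta a b <= K1) :
  (exists C1 C2 : R, [/\ 0 < C1, 0 < C2 & forall k : nat,
     ('E_P[fun w => (enorm (x k w - xstar f (y k w)) ^+ 2)%R]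
        <= (C1 / k.+1%:R `^ a)%:E)%E /\
     ('E_P[fun w => (enorm (g (xstar f (y k w)) (y k w) - y k w) ^+ 2)%R]
        <= (C2 / k.+1%:R `^ (1 - b))%:E)%E]) /\
  {ae P, forall w,
     (fun k => enorm (x k w - xstar f (y k w))) @ \oo --> (0 : R) /\
     (fun k => edist_set (y k w) (Ystar f g)) @ \oo --> (0 : R)}.
Proof.
case/andP: hmu => mu_ge0 mu_lt1; case/andP: halpha => al0 al1.
case/andP: hbeta => be0 be1; case: hYstar => ys hys.
have a_gt0 : 0 < a by lra.
have b_gt0 : 0 < b by lra.
have b2 : 2^-1 < b by lra.
have a_lt1 : a < 1 by lra.
have K0 : 0 < K1 by lra.
move: hgamma2; rewrite /gamma2 ge_max => /andP[hg1 hg2].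
pose al := stepsize alpha a K1; pose be := stepsize beta b K1.
pose tau := sq_tail alpha a K1; pose wt k := (k%:R + K1) `^ (1 - b).
have alk0 k : 0 < al k by exact: stepsize_gt0.
have bek0 k : 0 < be k by exact: stepsize_gt0.
have alk1 k : al k <= 2^-1 by apply: stepsize_le_half => //; exact: ltW.
have bek1 k : be k <= 2^-1 by apply: stepsize_le_half => //; exact: ltW.
have beal k : be k ^+ 2 <= al k ^+ 3 by exact: sqr_ratio_le.
have tau0 k : 0 <= tau k by exact: sq_tail_ge0.
have altau k : al k ^+ 2 <= tau k - tau k.+1 by exact: stepsize_sqr_le.
(* The first entry of [gamma2] serves here with rate q = 1 - mu, the second one below with q = 1. *)
have alS k : (1 - (1 - mu) / 2 * al k) * al k <= al k.+1.
  by apply: stepsize_ratio => //; rewrite subr_gt0.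
have beS k : (1 - 1 / 2 * be k) * be k <= be k.+1.
  by apply: stepsize_ratio => //; rewrite (mul1r beta).
have n0 k : 0 < k%:R + K1 by rewrite ltr_wpDl.
have wt0 k : 0 < wt k by exact: powR_gt0.
(* The first summand turns n^-b into [be k], the second is the constant of [weight_product_le]. *)
pose Cw := beta^-1 + alpha ^+ 2 / beta.
have Cw0 : 0 <= Cw by rewrite addr_ge0 ?divr_ge0 ?sqr_ge0 ?invr_ge0 ?(ltW be0).
have wtS k : wt k.+1 <= wt k + Cw * be k.
  apply: (le_trans (powR_weight_step k b_gt0 hb hK1)); rewrite lerD2l.
  have -> : (k%:R + K1) `^ (- b) = beta^-1 * be k.
    by rewrite /be /stepsize powRN mulKf// gt_eqF.
  by rewrite ler_wpM2r ?(ltW (bek0 k))// lerDl divr_ge0 ?sqr_ge0// ltW.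
have wtal k : wt k * be k * al k <= Cw * al k ^+ 2.
  apply: (le_trans (weight_product_le al0 be0 ha hb hK1 (beal k))).
  by rewrite ler_wpM2r ?sqr_ge0// lerDr invr_ge0 ltW.
have key : (exists2 C, 0 < C & forall k,
  [/\ rintegrable P (fun w => enorm (x k w - xstar f (y k w)) ^+ 2),
      \int[P]_w (enorm (x k w - xstar f (y k w)) ^+ 2) <= C * al k,
      rintegrable P (fun w => enorm (g (xstar f (y k w)) (y k w) - y k w) ^+ 2) &
      \int[P]_w (enorm (g (xstar f (y k w)) (y k w) - y k w) ^+ 2) <=
        C * ((wt k)^-1 + be k)]).
  exact: (mean_square_rates mu_ge0 mu_lt1 hcontr hnonexp hys hL hLip alk0 alk1
    bek0 bek1 beal tau0 altau alS beS hx0 hy0 hx hy hMmeas hM'meas hM hM' hc2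
    hvar Cw0 wt0 wtS wtal).
split; last first.
  apply: (almost_sure_convergence mu_ge0 mu_lt1 hcontr hnonexp hys hL hLip alk0 alk1
    bek0 bek1 beal tau0 altau alS beS hx0 hy0 hx hy hMmeas hM'meas hM hM' hc2
    hvar Cw0 wt0 wtS wtal).
    exact: sq_tail_cvg0.
  under eq_fun do rewrite /wt -powRN.
  by apply: powR_shift_cvg0 => //; lra.
have [C C0 hC] := key.
exists (C * alpha), (C * (1 + beta)); split.
- exact: mulr_gt0.
- by rewrite mulr_gt0// addr_gt0.
move=> k; have [i1 h1 i2 h2] := hC k.
split; rewrite unlock -EFin_Rint// lee_fin.
  apply: (le_trans h1); rewrite -mulrA ler_wpM2l ?(ltW C0)//.
  by apply: stepsize_le => //; exact: ltW.
apply: (le_trans h2); rewrite -mulrA ler_wpM2l ?(ltW C0)// mulrDl mul1r.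
have b1 : 0 <= 1 - b by lra.
apply: lerD.
  (* The inverse weight is itself a step size, with numerator 1 and exponent 1 - b. *)
  have := stepsize_le k ltr01 b1 hK1.
  by rewrite /stepsize !mul1r.
apply: (le_trans (stepsize_le k be0 (ltW b_gt0) hK1)).
(* As b > 1/2, the averaged-noise term k^-b decays at least as fast as k^-(1-b). *)
rewrite ler_wpM2l ?(ltW be0)// lef_pV2 ?posrE ?powR_gt0//.
by rewrite ler_powR ?ler1n//; lra.
Qed.
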